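(* There exist pairs $(\Gamma,H)$, with $\Gamma$ a group and $H$ a normal subgroup of $\Gamma$ of prime index, such that $\Gamma$ is in $\mathbf{LH}\mathscr{F}$ (and hence $(\Gamma,H)$ satisfies Moore's conjecture) and the corresponding Bockstein $\beta_{\Gamma,H}\in H^2(\Gamma,\mathbb{Z})$ is not nilpotent in $H^*(\Gamma,\mathbb{Z})$.
   Context: Let $\Gamma$ be a group and $H$ a subgroup of finite index. The pair $(\Gamma,H)$ satisfies Moore's condition if $\Gamma - H$ (set-theoretic complement) contains no element of prime order. Moore's conjecture holds for $(\Gamma,H)$ (equivalently, $(\Gamma,H)$ satisfies Moore's conjecture) if (a) $(\Gamma,H)$ satisfies Moore's condition, and (b) every $\mathbb{Z}\Gamma$-module which is projective over $\mathbb{Z}H$ is also projective over $\mathbb{Z}\Gamma$. Bockstein: if $H$ is normal in $\Gamma$ of prime index $p$, let $\widehat{\beta}\in H^2(\Gamma/H,\mathbb{Z})$ (trivial coefficients) be the class of the non-split extension $1\to\mathbb{Z}\to\mathbb{Z}\to\Gamma/H\cong\mathbb{Z}_p\to 1$, where $\mathbb{Z}_p$ is the cyclic group of order $p$. The Bockstein of $(\Gamma,H)$ is $\beta_{\Gamma,H}=\inf_{\Gamma/H}^{\Gamma}(\widehat{\beta})\in H^2(\Gamma,\mathbb{Z})$, where $\inf$ is inflation. Kropholler's hierarchy: for a class of groups $\mathscr{X}$, $\mathbf{H}_1\mathscr{X}$ is the class of all groups $G$ which act cellularly on some contractible finite dimensional CW-complex $X$ such that the setwise and pointwise stabilizers of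 each cell coincide and the stabilizers of the cells belong to $\mathscr{X}$. Put $\mathbf{H}_0\mathscr{X}=\mathscr{X}$, $\mathbf{H}_{\alpha+1}\mathscr{X}=\mathbf{H}_1(\mathbf{H}_\alpha\mathscr{X})$, $\mathbf{H}_\lambda\mathscr{X}=\bigcup_{\gamma<\lambda}\mathbf{H}_\gamma\mathscr{X}$ for limit ordinals $\lambda$, and let $\mathbf{H}\mathscr{X}$ be the union of $\mathbf{H}_\alpha\mathscr{X}$ over all ordinals $\alpha$. Let $\mathscr{F}$ be the class of finite groups. $\mathbf{LH}\mathscr{F}$ is the class of groups all of whose finitely generated subgroups belong to $\mathbf{H}\mathscr{F}$. *)

(* Defs.v *)
From HB Require Import structures.
From mathcomp Require Import all_boot all_order all_algebra.
From mathcomp Require Import generic_quotient ring_quotient.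
From mathcomp Require Import boolp classical_sets functions cardinality wochoice.
From mathcomp Require Import reals topology normedtype.
From mathcomp Require Import ring.
Set Implicit Arguments.
Unset Strict Implicit.
Unset Printing Implicit Defensive.
Import Order.TTheory GRing.Theory Num.Theory.
Import numFieldNormedType.Exports.
Local Open Scope classical_set_scope.
Local Open Scope ring_scope.

(* Groups are multiplicative [groupType]s, possibly infinite.  A subgroup of G *)
(* is a predicate closed under the group operations, [S : groupClosed G].      *)

Section SubgroupAsGroup.
Variables (G : groupType) (S : groupClosed G).

Record subgroup_type := SubgroupElt { sg_val : G; _ : sg_val \in S }.

HB.instance Definition _ := [isSub for sg_val].
HB.instance Definition _ := [Choice of subgroup_type by <:].

Fact subgroup_closed : group_closed [pred x | x \in S].
Proof.
split=> [|x y xS yS]; first exact: gpred1.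
exact: gpredF.
Qed.

HB.instance Definition _ :=
  SubChoice_isSubGroup.Build G _ subgroup_type subgroup_closed.

End SubgroupAsGroup.

Record normal_subgroup (G : groupType) := NormalSubgroup {
  normal_carrier :> groupClosed G;
  normalP : forall x y : G, x \in normal_carrier -> (x ^ y)%g \in normal_carrier
}.

Definition left_coset (G : groupType) (S : groupClosed G) (x : G) : set G :=
  [set y | (x^-1 * y)%g \in S].

Definition has_index (G : groupType) (S : groupClosed G) (n : nat) : Prop :=
  (range (left_coset S) #= `I_n)%card.

Section QuotientGroup.
Local Open Scope quotient_scope.
Local Open Scope group_scope.
Variables (G : groupType) (N : normal_subgroup G).

Definition same_coset (x y : G) : bool := x^-1 * y \in (N : groupClosed G).

Fact same_coset_equiv : equiv_class_of same_coset.
Proof.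
rewrite /same_coset; split=> [x|x y|y x z]; first by rewrite mulVg gpred1.
  by rewrite -gpredV invgM invgK.
by move=> yx xz; have := gpredM _ _ yx xz; rewrite mulgA mulgK.
Qed.

Canonical same_coset_equivRel := EquivRelPack same_coset_equiv.
Canonical same_coset_encModRel := defaultEncModRel same_coset.

Definition quotient_group := {eq_quot same_coset}.
HB.instance Definition _ : EqQuotient G same_coset quotient_group :=
  EqQuotient.on quotient_group.
HB.instance Definition _ := Choice.on quotient_group.

Lemma same_cosetE x y : (x == y %[mod quotient_group]) = same_coset x y.
Proof. by rewrite piE. Qed.

Definition quotient_one : quotient_group := lift_cst quotient_group 1.
Definition quotient_mul := lift_op2 quotient_group *%g.
Definition quotient_inv := lift_op1 quotient_group (fun x : G => x^-1).

Canonical quotient_one_morph := PiConst quotient_one.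

Fact pi_quotient_mul : {morph \pi : x y / x * y >-> quotient_mul x y}.
Proof.
move=> x y /=; unlock quotient_mul; apply/eqP; rewrite same_cosetE /same_coset.
have: same_coset x (repr (\pi_(quotient_group) x)) by rewrite -same_cosetE reprK.
have: same_coset y (repr (\pi_(quotient_group) y)) by rewrite -same_cosetE reprK.
rewrite /same_coset; move: (repr _) (repr _) => x' y' Ny Nx.
have -> : (x * y)^-1 * (x' * y') = (x^-1 * x') ^ y * (y^-1 * y').
  by rewrite invgM /conjg !mulgA mulgK.
by rewrite gpredM ?normalP.
Qed.
Canonical pi_quotient_mul_morph := PiMorph2 pi_quotient_mul.

Fact pi_quotient_inv : {morph \pi : x / x^-1 >-> quotient_inv x}.
Proof.
move=> x /=; unlock quotient_inv; apply/eqP; rewrite same_cosetE /same_coset.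
have: same_coset x (repr (\pi_(quotient_group) x)) by rewrite -same_cosetE reprK.
rewrite /same_coset; move: (repr _) => x' Nx.
rewrite -gpredV invgM !invgK.
have -> : x' * x^-1 = (x^-1 * x') ^ x^-1 by rewrite /conjg invgK !mulgA mulgV mul1g.
exact: normalP.
Qed.
Canonical pi_quotient_inv_morph := PiMorph1 pi_quotient_inv.

Fact quotient_mulA : associative quotient_mul.
Proof. by move=> x y z; rewrite -[x]reprK -[y]reprK -[z]reprK !piE mulgA. Qed.
Fact quotient_mul1g : left_id quotient_one quotient_mul.
Proof. by move=> x; rewrite -[x]reprK !piE mul1g. Qed.
Fact quotient_mulg1 : right_id quotient_one quotient_mul.
Proof. by move=> x; rewrite -[x]reprK !piE mulg1. Qed.
Fact quotient_mulVg : left_inverse quotient_one quotient_inv quotient_mul.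
Proof. by move=> x; rewrite -[x]reprK !piE mulVg. Qed.
Fact quotient_mulgV : right_inverse quotient_one quotient_inv quotient_mul.
Proof. by move=> x; rewrite -[x]reprK !piE mulgV. Qed.

HB.instance Definition _ := isGroup.Build quotient_group quotient_mulA
  quotient_mul1g quotient_mulg1 quotient_mulVg quotient_mulgV.

Definition quotient_map (x : G) : quotient_group := \pi_(quotient_group) x.

Fact quotient_mapM : {morph quotient_map : x y / x * y}.
Proof. by move=> x y; rewrite /quotient_map pi_quotient_mul. Qed.

HB.instance Definition _ :=
  isMultiplicative.Build G quotient_group quotient_map quotient_mapM.

End QuotientGroup.

(* Integral cohomology from the inhomogeneous bar complex, trivial coefficients. *)
(* A function on words of G is a family (f_n) of functions f_n : G^n -> Z; it    *)
(* lies in the direct sum of the C^n(G, Z) when it is bounded, i.e. vanishes on  *)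
(* all long enough words.                                                        *)

Definition cochain (G : groupType) : Type := seq G -> int.

HB.instance Definition _ (G : groupType) :=
  GRing.Zmodule.copy (cochain G) (seq G -> int).

Section CochainRing.
Variable G : groupType.
Implicit Types (f g h : cochain G) (x y : G) (s : seq G).

Definition cup f g : cochain G :=
  fun s => \sum_(i < (size s).+1) f (take i s) * g (drop i s).

Definition cochain_one : cochain G := fun s => (s == [::])%:R.

(* The i-th face of (x_1, ..., x_n), for i <= n.                               *)
Definition face (i : nat) s : seq G :=
  if i == 0%N then behead s
  else if i == size s then take i.-1 s
  else take i.-1 s ++ (nth 1 s i.-1 * nth 1 s i)%g :: drop i.+1 s.

Definition codiff f : cochain G := fun s =>
  if s is [::] then 0
  else \sum_(i < (size s).+1) (-1) ^+ i * f (face i s).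

Definition shift x f : cochain G := fun s => f (x :: s).

Lemma cochainD f g s : (f + g) s = f s + g s. Proof. by []. Qed.
Lemma cochainN f s : (- f) s = - f s. Proof. by []. Qed.
Lemma cochainB f g s : (f - g) s = f s - g s. Proof. by []. Qed.

Lemma cup_nil f g : cup f g [::] = f [::] * g [::].
Proof. by rewrite /cup /= big_ord_recl big_ord0 addr0. Qed.

Lemma cup_cons f g x s :
  cup f g (x :: s) = f [::] * g (x :: s) + cup (shift x f) g s.
Proof. by rewrite /cup /= big_ord_recl. Qed.

Lemma cupDl f1 f2 g s : cup (f1 + f2) g s = cup f1 g s + cup f2 g s.
Proof. by rewrite -big_split; apply: eq_bigr => i _; rewrite /= mulrDl. Qed.

Lemma cupDr f g1 g2 s : cup f (g1 + g2) s = cup f g1 s + cup f g2 s.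
Proof. by rewrite -big_split; apply: eq_bigr => i _; rewrite /= mulrDr. Qed.

Lemma cupNl f g s : cup (- f) g s = - cup f g s.
Proof. by rewrite -sumrN; apply: eq_bigr => i _; rewrite /= mulNr. Qed.

Lemma cupZl (a : int) f g s : cup (fun t => a * f t) g s = a * cup f g s.
Proof. by rewrite /cup mulr_sumr; apply: eq_bigr => i _; rewrite mulrA. Qed.

Lemma shift_cup x f g :
  shift x (cup f g) = (fun t => f [::] * shift x g t) + cup (shift x f) g.
Proof. by apply/funext=> t; rewrite /shift cup_cons. Qed.

Fact cupA : associative cup.
Proof.
move=> f g h; apply/funext=> s; elim: s f => [|x s IHs] f.
  by rewrite !cup_nil mulrA.
by rewrite !cup_cons shift_cup cupDl cupZl cup_nil IHs; ring.
Qed.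

Fact cup1l : left_id cochain_one cup.
Proof.
move=> f; apply/funext=> -[|x s]; first by rewrite cup_nil mul1r.
rewrite cup_cons mul1r /cup big1 ?addr0// => i _.
by rewrite /shift /cochain_one mul0r.
Qed.

Fact cup1r : right_id cochain_one cup.
Proof.
move=> f; apply/funext=> s; elim: s f => [|x s IHs] f.
  by rewrite cup_nil mulr1.
by rewrite cup_cons mulr0 add0r IHs.
Qed.

Fact cup_addl : left_distributive cup +%R.
Proof. by move=> f1 f2 g; apply/funext=> s; rewrite cupDl. Qed.
Fact cup_addr : right_distributive cup +%R.
Proof. by move=> f g1 g2; apply/funext=> s; rewrite cupDr. Qed.

HB.instance Definition _ := GRing.Zmodule_isPzRing.Build (cochain G)
  cupA cup1l cup1r cup_addl cup_addr.

(* [codiff] without the 0-th face, by recursion on the word; proof device.     *)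
Fixpoint tail_diff x s f : int :=
  if s is y :: s' then f ((x * y)%g :: s') - tail_diff y s' (shift x f)
  else f [::].

Lemma codiff_cons f x s : codiff f (x :: s) = f s - tail_diff x s f.
Proof.
rewrite /codiff /= big_ord_recl /= expr0 mul1r; congr (_ + _).
elim: s x f => [|y s IHs] x f.
  by rewrite big_ord_recl big_ord0 /= addr0 /face /= expr1 mulN1r.
rewrite big_ord_recl /= opprB [RHS]addrC -[tail_diff _ _ _]opprK -IHs -sumrN.
congr (_ + _); first by rewrite /face /= drop0 expr1 mulN1r.
apply: eq_bigr => i _; rewrite /bump /= !add1n exprS mulN1r mulNr.
congr (- (_ * _)); rewrite /shift /face /= !eqSS.
by case: ifP.
Qed.

Lemma tail_diffD x s f g :
  tail_diff x s (f + g) = tail_diff x s f + tail_diff x s g.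
Proof.
elim: s x f g => [//|y s IHs] x f g /=.
by rewrite -[shift x (f + g)]/(shift x f + shift x g) IHs cochainD; ring.
Qed.

Lemma tail_diffZ x s (a : int) f :
  tail_diff x s (fun t => a * f t) = a * tail_diff x s f.
Proof.
elim: s x f => [//|y s IHs] x f /=.
by rewrite -[shift x (fun t => _)]/(fun t => a * shift x f t) IHs; ring.
Qed.

Lemma codiffB f g : codiff (f - g) = codiff f - codiff g.
Proof.
apply/funext=> -[|x s]; first by rewrite cochainB subrr.
rewrite cochainB !codiff_cons tail_diffD cochainB.
have -> : - g = fun t => -1 * g t by apply/funext=> t; rewrite mulN1r.
by rewrite tail_diffZ; ring.
Qed.

Definition parity f : cochain G := fun s => (-1) ^+ size s * f s.

Lemma parity_shift x f : shift x (parity f) = - parity (shift x f).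
Proof. by apply/funext=> t; rewrite cochainN /shift /parity /= exprS; ring. Qed.

Lemma parityK f : parity (parity f) = f.
Proof. by apply/funext=> s; rewrite /parity mulrA -expr2 sqrr_sign mul1r. Qed.

Lemma codiff_parity f : codiff (parity f) = - parity (codiff f).
Proof.
apply/funext=> -[|x s]; rewrite cochainN /parity ?mulr0 ?oppr0//.
rewrite !codiff_cons /=.
suff -> : tail_diff x s (parity f) = (-1) ^+ size s * tail_diff x s f.
  by rewrite exprS; ring.
elim: s x f => [//|y s IHs] x f /=.
rewrite parity_shift.
have -> : - parity (shift x f) = fun t => -1 * parity (shift x f) t.
  by apply/funext=> t; rewrite mulN1r.
by rewrite tail_diffZ IHs /parity /= exprS; ring.
Qed.

Lemma codiffM f g : codiff (f * g) = codiff f * g + parity f * codiff g.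
Proof.
have key x s f' : tail_diff x s (f' * g) =
    cup (fun t => tail_diff x t f') g s - f' [::] * (g s - tail_diff x s g)
    + cup (parity (shift x f')) (codiff g) s.
  elim: s x f' => [|y s IHs] x f'.
    by rewrite /= [(f' * g) _]cup_nil !cup_nil /=; ring.
  rewrite /= !cup_cons codiff_cons.
  rewrite [shift x (f' * g)]shift_cup tail_diffD tail_diffZ IHs parity_shift cupNl.
  have -> : shift y (fun t => tail_diff x t f') =
      shift (x * y)%g f' + - (fun t => tail_diff y t (shift x f')) by [].
  rewrite cupDl cupNl [(f' * g) _]cup_cons /parity /shift /= expr0; ring.
apply/funext=> -[|x s].
  by rewrite cochainD [(codiff f * g) _]cup_nil [(parity f * codiff g) _]cup_nil /=;
     ring.
rewrite cochainD codiff_cons [(codiff f * g) _]cup_cons.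
rewrite [(parity f * codiff g) _]cup_cons key parity_shift cupNl codiff_cons.
have -> : shift x (codiff f) = f - (fun t => tail_diff x t f).
  by apply/funext=> t; rewrite /shift codiff_cons.
rewrite cupDl cupNl /parity /= expr0 [(f * g) s]/(cup f g s); ring.
Qed.

End CochainRing.

Section CohomologyRing.
Variable G : groupType.
Implicit Types f g : cochain G.

Definition bounded_cochain f := exists n, forall s : seq G, (n < size s)%N -> f s = 0.

Fact bounded_cochainB f g :
  bounded_cochain f -> bounded_cochain g -> bounded_cochain (f - g).
Proof.
move=> [m fm] [n gn]; exists (maxn m n) => s; rewrite gtn_max => /andP[ms ns].
by rewrite cochainB fm ?gn.
Qed.

Fact bounded_cup f g :
  bounded_cochain f -> bounded_cochain g -> bounded_cochain (f * g).
Proof.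
move=> [m fm] [n gn]; exists (m + n)%N => s mns.
rewrite [LHS]/(cup f g s) /cup big1// => i _.
have is_ : (i <= size s)%N by rewrite -ltnS.
case: (ltnP m i) => mi; first by rewrite fm ?mul0r// size_takel.
rewrite gn ?mulr0// size_drop ltn_subRL.
by apply: leq_ltn_trans mns; rewrite leq_add2r.
Qed.

Fact bounded_parity f : bounded_cochain f -> bounded_cochain (parity f).
Proof. by move=> [n fn]; exists n => s /fn; rewrite /parity => ->; rewrite mulr0. Qed.

Definition is_cocycle : {pred cochain G} :=
  fun f => `[< bounded_cochain f /\ codiff f = 0 >].

Fact is_cocycle_closed : subring_closed is_cocycle.
Proof.
split.
- apply/asboolP; split; first by exists 0%N; case.
  have e1 : codiff (1 : cochain G) = codiff 1 + codiff 1.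
    have := codiffM (1 : cochain G) 1; rewrite mulr1 mulr1.
    have -> : parity (1 : cochain G) = 1.
      by apply/funext=> -[|x s]; rewrite /parity ?mul1r// mulr0.
    by rewrite mul1r.
  by apply: (addrI (codiff (1 : cochain G))); rewrite addr0 -e1.
- move=> f g /asboolP[bf df] /asboolP[bg dg]; apply/asboolP; split.
    exact: bounded_cochainB.
  by rewrite codiffB df dg subrr.
- move=> f g /asboolP[bf df] /asboolP[bg dg]; apply/asboolP; split.
    exact: bounded_cup.
  by rewrite codiffM df dg mul0r mulr0 addr0.
Qed.

HB.instance Definition _ :=
  GRing.isSubringClosed.Build (cochain G) is_cocycle is_cocycle_closed.

Record cocycle := Cocycle { cocycle_val :> cochain G; _ : is_cocycle cocycle_val }.

HB.instance Definition _ := [isSub for cocycle_val].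
HB.instance Definition _ := [Choice of cocycle by <:].
HB.instance Definition _ := 
  GRing.SubChoice_isSubPzRing.Build (cochain G) is_cocycle cocycle is_cocycle_closed.

Lemma cocycleP (z : cocycle) : bounded_cochain z /\ codiff z = 0.
Proof. by apply/asboolP; apply: (valP z). Qed.

Definition is_coboundary : {pred cocycle} :=
  fun z => `[< exists2 f : cochain G, bounded_cochain f & z = codiff f :> cochain G >].

Fact is_coboundary_closed : zmod_closed is_coboundary.
Proof.
split.
  apply/asboolP; exists 0; first by exists 0%N.
  by apply: (addrI (codiff (0 : cochain G))); rewrite -{1}(subrr 0) codiffB subrr.
move=> y z /asboolP[f bf yf] /asboolP[g bg zg]; apply/asboolP.
by exists (f - g); [exact: bounded_cochainB | rewrite codiffB -yf -zg].
Qed.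

HB.instance Definition _ := GRing.isZmodClosed.Build cocycle is_coboundary
  is_coboundary_closed.

Fact coboundaryMr (z b : cocycle) : b \in is_coboundary -> b * z \in is_coboundary.
Proof.
move=> /asboolP[f bf bE]; apply/asboolP; exists (f * cocycle_val z).
  by apply: bounded_cup => //; case: (cocycleP z).
rewrite codiffM -bE; case: (cocycleP z) => _ ->.
by rewrite mulr0 addr0.
Qed.

Fact coboundaryMl (z b : cocycle) : b \in is_coboundary -> z * b \in is_coboundary.
Proof.
have [bz dz] := cocycleP z.
move=> /asboolP[f bf bE]; apply/asboolP; exists (parity z * f).
  by apply: bounded_cup => //; apply: bounded_parity.
rewrite codiffM codiff_parity dz parityK -bE.
suff -> : parity (0 : cochain G) = 0 by rewrite oppr0 mul0r add0r.
by apply/funext=> s; rewrite /parity mulr0.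
Qed.

(* The ring H^*(G, Z), i.e. the direct sum of the H^n(G, Z).                   *)
Definition cohomology := Quotient.quot is_coboundary.

HB.instance Definition _ := GRing.Zmodule.on cohomology.
HB.instance Definition _ := EqQuotient.on cohomology.

Local Open Scope quotient_scope.

Lemma cohomology_eq (y z : cocycle) :
  (y == z %[mod cohomology]) = (y - z \in is_coboundary).
Proof. by rewrite -Quotient.idealrBE. Qed.

Lemma repr_coboundary (z : cocycle) :
  z - repr (\pi_(cohomology) z) \in is_coboundary.
Proof. by rewrite -cohomology_eq reprK. Qed.

Definition cohomology_one : cohomology := lift_cst cohomology 1.
Definition cohomology_mul := lift_op2 cohomology *%R.

Canonical cohomology_one_morph := PiConst cohomology_one.

Fact pi_cohomology_mul : {morph \pi : y z / y * z >-> cohomology_mul y z}.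
Proof.
move=> y z /=; unlock cohomology_mul; apply/eqP; rewrite cohomology_eq.
move: (repr_coboundary y) (repr_coboundary z).
move: (repr _) (repr _) => z' y' by_ bz_.
have -> : y * z - y' * z' = (y - y') * z + y' * (z - z').
  by rewrite mulrBl mulrBr addrA subrK.
by apply: rpredD; [exact: coboundaryMr | exact: coboundaryMl].
Qed.
Canonical pi_cohomology_mul_morph := PiMorph2 pi_cohomology_mul.

Fact cohomology_mulA : associative cohomology_mul.
Proof. by move=> x y z; rewrite -[x]reprK -[y]reprK -[z]reprK !piE mulrA. Qed.
Fact cohomology_mul1r : left_id cohomology_one cohomology_mul.
Proof. by move=> x; rewrite -[x]reprK !piE mul1r. Qed.
Fact cohomology_mulr1 : right_id cohomology_one cohomology_mul.
Proof. by move=> x; rewrite -[x]reprK !piE mulr1. Qed.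

Fact cohomology_mulDl : left_distributive cohomology_mul +%R.
Proof.
by move=> x y z; rewrite -[x]reprK -[y]reprK -[z]reprK !piE mulrDl.
Qed.
Fact cohomology_mulDr : right_distributive cohomology_mul +%R.
Proof.
by move=> x y z; rewrite -[x]reprK -[y]reprK -[z]reprK !piE mulrDr.
Qed.

HB.instance Definition _ := GRing.Zmodule_isPzRing.Build cohomology
  cohomology_mulA cohomology_mul1r cohomology_mulr1
  cohomology_mulDl cohomology_mulDr.

Definition cohomology_class (z : cocycle) : cohomology := \pi_(cohomology) z.

End CohomologyRing.

Section Inflation.
Local Open Scope quotient_scope.
Variables (G Q : groupType) (phi : {multiplicative G -> Q}).

Definition pullback (f : cochain Q) : cochain G := fun s => f (map phi s).

Lemma codiff_pullback f : codiff (pullback f) = pullback (codiff f).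
Proof.
apply/funext=> -[//|x s]; rewrite /pullback /codiff /= size_map.
apply: eq_bigr => i _; congr (_ * f _).
have /= im := ltn_ord i.
rewrite /face /= size_map; case: eqP => // i0; case: eqP => iN.
  by rewrite map_take.
have i1 : (i.-1 < (size s).+1)%N by move: im i0; case: (nat_of_ord i).
have i2 : (i < (size s).+1)%N by rewrite ltn_neqAle -ltnS im andbT; apply/eqP.
rewrite map_cat /= map_take map_drop gmulfM.
by rewrite -!(nth_map 1%g 1%g phi (s := x :: s)).
Qed.

Fact pullback_is_cocycle (z : cocycle Q) : is_cocycle (pullback z).
Proof.
have [[n zn] dz] := cocycleP z; apply/asboolP; split.
  by exists n => s ns; rewrite /pullback zn ?size_map.
by rewrite codiff_pullback dz.
Qed.

Definition pullback_cocycle (z : cocycle Q) : cocycle G :=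
  Cocycle (pullback_is_cocycle z).

Definition inflation (a : cohomology Q) : cohomology G :=
  cohomology_class (pullback_cocycle (repr a)).

Lemma inflation_class (z : cocycle Q) :
  inflation (cohomology_class z) = cohomology_class (pullback_cocycle z).
Proof.
apply/eqP; rewrite eq_sym /inflation /cohomology_class cohomology_eq.
have /asboolP[f bf zf] := repr_coboundary z.
apply/asboolP; exists (pullback f).
  by have [n fn] := bf; exists n => s ns; rewrite /pullback fn ?size_map.
by rewrite codiff_pullback -zf.
Qed.

End Inflation.

(* An extension 1 -> Z -> Z -> Q -> 1 whose first map is multiplication by p.  *)
(* For Q cyclic of order p such maps q are the compositions of Z -> Z/p with   *)
(* the isomorphisms Z/p -> Q.                                                  *)
Record Z_extension (p : nat) (Q : groupType) := ZExtension {
  ext_proj :> int -> Q;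
  ext_projD : forall a b : int, ext_proj (a + b) = (ext_proj a * ext_proj b)%g;
  ext_proj_surj : forall x : Q, exists a, ext_proj a = x;
  ext_proj_ker : forall a : int, ext_proj a = 1%g <-> (p %| a)%Z
}.

Section ExtensionClass.
Variables (p : nat) (Q : groupType) (q : Z_extension p Q).

Definition ext_section (x : Q) : int := sval (cid (ext_proj_surj q x)).

Lemma ext_sectionK x : q (ext_section x) = x.
Proof. exact: svalP (cid (ext_proj_surj q x)). Qed.

(* The element of the kernel Z carried by s(x) + s(y) - s(xy).                 *)
Definition ext_factor (x y : Q) : int :=
  ((ext_section x + ext_section y - ext_section (x * y)%g) %/ p)%Z.

Lemma ext_factorE x y : ext_factor x y * p%:Z =
  ext_section x + ext_section y - ext_section (x * y)%g.
Proof.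
rewrite divzK//; apply/(ext_proj_ker q).
have qN (a : int) : q (- a) = (q a)^-1%g.
  apply: (mulgI (q a)); rewrite -ext_projD subrr mulgV.
  by apply/(ext_proj_ker q); exact: dvdz0.
by rewrite !ext_projD qN !ext_sectionK mulgV.
Qed.

Definition ext_cochain : cochain Q :=
  fun s => if s is [:: x; y] then ext_factor x y else 0.

Fact ext_cochain_is_cocycle : is_cocycle ext_cochain.
Proof.
apply/asboolP; split; first by exists 2 => -[|x [|y [|z s]]].
apply/funext=> -[//|x s]; rewrite codiff_cons.
case: s => [|y [|z [|t s]]]; rewrite /= /shift /= ?subrr ?oppr0 ?subr0//.
  case: (p =P 0%N) => [p0|/eqP p0].
    rewrite /ext_factor p0 !divz0; ring.
  apply: (@mulIf _ p%:Z) => //; rewrite mul0r !mulrBl !ext_factorE mulgA; ring.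
have -> : tail_diff t s (fun=> 0) = 0.
  by elim: s t => [//|u s IHs] t /=; rewrite IHs subrr.
by rewrite !subr0.
Qed.

Definition ext_class : cohomology Q :=
  cohomology_class (Cocycle ext_cochain_is_cocycle).

End ExtensionClass.

Definition bockstein (p : nat) (G : groupType) (H : normal_subgroup G)
    (q : Z_extension p (quotient_group H)) : cohomology G :=
  inflation (quotient_map H) (ext_class q).

Section Modules.
Variable G : groupType.

(* A Z[G]-module: an abelian group with an additive action of G.               *)
Record gmodule := GModule {
  gmodule_carrier :> zmodType;
  gact : G -> gmodule_carrier -> gmodule_carrier;
  gact1 : forall m, gact 1%g m = m;
  gactM : forall x y m, gact (x * y)%g m = gact x (gact y m);
  gactD : forall x m n, gact x (m + n) = gact x m + gact x n
}.

Definition gmodule_hom (M N : gmodule) (f : M -> N) : Prop :=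
  (forall m n, f (m + n) = f m + f n) /\
  (forall x m, f (gact x m) = gact x (f m)).

Definition projective_gmodule (P : gmodule) : Prop :=
  forall (M N : gmodule) (g : M -> N) (f : P -> N),
    gmodule_hom g -> (forall n, exists m, g m = n) -> gmodule_hom f ->
  exists2 h : P -> M, gmodule_hom h & forall u, g (h u) = f u.

End Modules.

Section Restriction.
Variables (G : groupType) (H : groupClosed G) (M : gmodule G).

Definition res_gact (x : subgroup_type H) (m : M) : M := gact (sg_val x) m.

Fact res_gact1 m : res_gact 1%g m = m.
Proof. exact: gact1. Qed.
Fact res_gactM x y m : res_gact (x * y)%g m = res_gact x (res_gact y m).
Proof. exact: gactM. Qed.
Fact res_gactD x m n : res_gact x (m + n) = res_gact x m + res_gact x n.
Proof. exact: gactD. Qed.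

Definition res_gmodule : gmodule (subgroup_type H) :=
  GModule res_gact1 res_gactM res_gactD.

End Restriction.

Definition has_order (G : groupType) (x : G) (n : nat) : Prop :=
  [/\ (0 < n)%N, (x ^+ n)%g = 1%g &
      forall m, (0 < m < n)%N -> (x ^+ m)%g <> 1%g].

Definition moore_condition (G : groupType) (H : groupClosed G) : Prop :=
  forall (x : G) (l : nat), x \notin H -> prime l -> ~ has_order x l.

Definition moore_conjecture (G : groupType) (H : groupClosed G) : Prop :=
  moore_condition H /\
  forall M : gmodule G,
    projective_gmodule (res_gmodule H M) -> projective_gmodule M.

Section CWComplexes.
Variable R : realType.

Definition closed_disc n : set 'rV[R]_n := [set v | \sum_i v 0 i ^+ 2 <= 1].
Definition open_disc n : set 'rV[R]_n := [set v | \sum_i v 0 i ^+ 2 < 1].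
Definition disc_boundary n : set 'rV[R]_n := [set v | \sum_i v 0 i ^+ 2 = 1].

Arguments closed_disc : clear implicits.
Arguments open_disc : clear implicits.
Arguments disc_boundary : clear implicits.

Record cw_structure (X : topologicalType) := CWStructure {
  cw_index : Type;
  cw_dim : cw_index -> nat;
  cw_char : forall a, 'rV[R]_(cw_dim a) -> X;
  cw_cell : cw_index -> set X := fun a => @cw_char a @` open_disc (cw_dim a);
  cw_hausdorff : hausdorff_space X;
  cw_char_continuous : forall a,
    {within closed_disc (cw_dim a), continuous (@cw_char a)};
  cw_char_inj : forall a, {in open_disc (cw_dim a) &, injective (@cw_char a)};
  cw_char_open : forall a (U : set 'rV[R]_(cw_dim a)), open U ->
    exists2 V : set X, open V &
      @cw_char a @` (U `&` open_disc (cw_dim a)) = V `&` cw_cell a;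
  cw_cover : \bigcup_a cw_cell a = setT;
  cw_disjoint : forall a b, cw_cell a `&` cw_cell b !=set0 -> a = b;
  cw_closure_finite : forall a, exists S : set cw_index,
    [/\ finite_set S, forall b, S b -> (cw_dim b < cw_dim a)%N &
        @cw_char a @` disc_boundary (cw_dim a) `<=` \bigcup_(b in S) cw_cell b];
  cw_weak : forall A : set X,
    (forall a, closed (A `&` @cw_char a @` closed_disc (cw_dim a))) -> closed A
}.

Definition finite_dimensional (X : topologicalType) (C : cw_structure X) : Prop :=
  exists n, forall a : cw_index C, (cw_dim a <= n)%N.

Definition contractible (X : topologicalType) : Prop :=
  exists (x0 : X) (h : X * R -> X),
    [/\ {within setT `*` [set t : R | 0 <= t <= 1], continuous h},
        forall x, h (x, 0) = x & forall x, h (x, 1) = x0].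

Section CellularActions.
Variables (G : groupType) (X : topologicalType) (C : cw_structure X).

Record cellular_action := CellularAction {
  cact : G -> X -> X;
  cact1 : forall x, cact 1%g x = x;
  cactM : forall g h x, cact (g * h)%g x = cact g (cact h x);
  cact_continuous : forall g, continuous (cact g);
  cact_cellular : forall g (a : cw_index C), exists2 b : cw_index C,
    cw_dim b = cw_dim a & cact g @` cw_cell a = cw_cell b
}.

Variables (act : cellular_action) (a : cw_index C).

Definition pointwise_stabilizer : set G :=
  [set g | forall x, cw_cell a x -> cact act g x = x].

Definition setwise_stabilizer : {pred G} :=
  fun g => `[< cact act g @` cw_cell a = cw_cell a >].

Fact setwise_stabilizer1 : 1%g \in setwise_stabilizer.
Proof.
apply/asboolP; rewrite -[RHS]image_id.
by apply: eq_imagel => x _; rewrite cact1.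
Qed.

Fact setwise_stabilizerM : mulg_closed setwise_stabilizer.
Proof.
move=> g h /asboolP ga /asboolP ha; apply/asboolP.
rewrite -[RHS]ga -{2}ha image_comp.
by apply: eq_imagel => x _; rewrite cactM.
Qed.

Fact setwise_stabilizerV : invg_closed setwise_stabilizer.
Proof.
move=> g /asboolP ga; apply/asboolP.
rewrite -{1}ga image_comp -[RHS]image_id.
by apply: eq_imagel => x _ /=; rewrite -cactM mulVg cact1.
Qed.

HB.instance Definition _ := isMulClosed.Build G setwise_stabilizer
  setwise_stabilizerM.
HB.instance Definition _ := isMul1Closed.Build G setwise_stabilizer
  setwise_stabilizer1.
HB.instance Definition _ := isInvClosed.Build G setwise_stabilizer
  setwise_stabilizerV.

Definition cell_stabilizer : groupClosed G := setwise_stabilizer.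

End CellularActions.

End CWComplexes.

Definition group_class := groupType -> Prop.

Definition finite_groups : group_class := fun G => finite_set [set: G].

Section Hierarchy.
Variable R : realType.

Definition H1 (XX : group_class) : group_class := fun G =>
  exists (X : topologicalType) (C : cw_structure R X) (act : cellular_action G C),
    [/\ contractible R X, finite_dimensional C &
        forall a : cw_index C,
          [set g | g \in cell_stabilizer act a] = pointwise_stabilizer act a /\
          XX (subgroup_type (cell_stabilizer act a))].

(* The ordinals below a given one are represented by a well-ordered type W.    *)
Section Ordinals.
Variables (W : Type) (le : rel W).

Definition wlt (v w : W) : Prop := le v w /\ v <> w.
Definition is_zero (w : W) : Prop := forall v, ~ wlt v w.
Definition is_succ (v w : W) : Prop := wlt v w /\ forall u, wlt u w -> le u v.
Definition is_limit (w : W) : Prop := ~ is_zero w /\ forall v, ~ is_succ v w.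

(* F w is the class H_w XX; these clauses determine F when W is well-ordered.  *)
Definition H_levels (XX : group_class) (F : W -> group_class) : Prop :=
  forall w (G : groupType),
    [/\ is_zero w -> (F w G <-> XX G),
        forall v, is_succ v w -> (F w G <-> H1 (F v) G) &
        is_limit w -> (F w G <-> exists2 v, wlt v w & F v G)].

End Ordinals.

Definition H_class (XX : group_class) : group_class := fun G =>
  exists (W : Type) (le : rel W) (F : W -> group_class) (w : W),
    [/\ well_order le, H_levels le XX F & F w G].

End Hierarchy.

Definition finitely_generated (G : groupType) (S : groupClosed G) : Prop :=
  exists2 s : seq G, {subset s <= S} &
    forall K : groupClosed G, {subset s <= K} -> {subset S <= K}.

Definition LHF (R : realType) : group_class := fun G =>
  forall S : groupClosed G, finitely_generated S ->
    H_class R finite_groups (subgroup_type S).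

Definition nilpotent (A : pzRingType) (a : A) : Prop := exists n, a ^+ n = 0.

(* Main.v *)
From HB Require Import structures.
Require Import Defs.
From mathcomp Require Import all_boot all_order all_algebra.
From mathcomp Require Import boolp classical_sets functions cardinality wochoice.
From mathcomp Require Import reals topology normedtype.
From mathcomp Require Import zify ring lra.
Set Implicit Arguments.
Unset Strict Implicit.
Unset Printing Implicit Defensive.
Import Order.TTheory GRing.Theory Num.Theory.
Import numFieldNormedType.Exports.
Local Open Scope ring_scope.

(**
The group is an infinite tower of infinite cyclic groups.  Gamma consists of
the finitely supported sequences a of integers, with
  (a b)_i = a_i + (-1)^(a_(i+1)) b_i,
so that each coordinate acts on the preceding one by its sign, and H is the
subgroup where a_0 is even; chi is the parity of a_0.  Write s for the
generator of coordinate 0 and Gamma_n for the subgroup of the sequences that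
vanish from n on; it is a poly-infinite-cyclic group, the fundamental group of
a tower of n circle bundles.

Moore's condition.  If a a = 1 then a_i (1 + (-1)^(a_(i+1))) = 0 for all i, so
a_i odd forces a_(i+1) odd.  An element outside H with a a = 1 would have all
its coordinates odd, against finite support.

Non-nilpotency ([edge_exactS], [bockstein_not_nilpotent]).  The Bockstein is
the class of chi cup chi, so it suffices that no power of chi is a coboundary
mod 2.  There are two embeddings of Gamma into itself: iota ([embed]), which
inserts a first coordinate 0, and j ([embed_twist]), which inserts the parity of
a_0.  They agree on H, and chi pulls back to 0 along iota and to chi along j.  If chi^(n+1) = df then
F = j^* f + iota^* f satisfies dF = chi^(n+1) and vanishes on H.  Among the
H-invariant homogeneous cochains on Gamma, chi is the coboundary of the function
chi itself, so F + chi . chi^n is a cocycle; it vanishes on the words in H,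
hence is a coboundary dw, and the transfer of w from H to Gamma has coboundary
chi^n.  By descent 1 would be a coboundary.

Moore's conjecture ([exists_half_trace], [exists_global_half_trace]).  By
Higman's criterion a Gamma-module M that is projective over H is projective as
soon as id = f + s f s^-1 for some H-endomorphism f ([projective_of_half_trace]).
Such an f is built first for the subgroup H_n = H cap Gamma_n, by induction on
n, and then for H, the union of the H_n.  At each stage candidates for f on
pieces of the group must be made to agree, and the obstruction is a derivation
from a subgroup of H to the additive endomorphisms of M; as M is projective
over H, that derivation is inner ([derivation_on_inner]), which says how to
correct the candidates.  The inductive step uses that Gamma_(n+1) is the
amalgam of iota(Gamma_n) and j(Gamma_n) over iota(H_n): on the first M is already
projective, and on the second the induction hypothesis applies.

The class LHF ([line_level_below], [tower_LHF]).  Gamma acts on the line by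
x |-> (-1)^(a_1) x + 2 a_0.  The integers cut the line into vertices and edges;
no element of Gamma reverses an edge, because reflections have integral
centres.  The stabilizer of a point contains no translation, so deleting
coordinate 0 embeds it in the group of the remaining coordinates; a group that
embeds in Gamma_n is thus at level n of the hierarchy.
*)

(** * The group *)

Definition oddz (z : int) : bool := odd `|z|.

Definition flip (b : bool) (z : int) : int := if b then - z else z.

Lemma oddzD y z : oddz (y + z) = oddz y (+) oddz z.
Proof. rewrite /oddz; lia. Qed.

Lemma oddzN z : oddz (- z) = oddz z.
Proof. by rewrite /oddz abszN. Qed.

Lemma oddz_flip b z : oddz (flip b z) = oddz z.
Proof. by case: b; rewrite /flip ?oddzN. Qed.

Lemma oddzP z : oddz z = false -> z = 2 * (z %/ 2)%Z.
Proof. rewrite /oddz; lia. Qed.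

Definition finitely_supported : {pred nat -> int} :=
  fun a => `[< exists n, forall i, (n <= i)%N -> a i = 0 >].

(** Sequences of integers with finite support; the tower of semidirect products
    comes from [tower_mul], in which coordinate [i.+1] acts on coordinate [i] by
    its sign. *)
Record tower := Tower { coord :> nat -> int; _ : finitely_supported coord }.

HB.instance Definition _ := [isSub for coord].
HB.instance Definition _ := [Choice of tower by <:].

Lemma towerP (a b : tower) : (forall i, a i = b i) -> a = b.
Proof. by move=> ab; apply: val_inj; apply/funext. Qed.

Lemma tower_bound (a : tower) : exists n, forall i, (n <= i)%N -> a i = 0.
Proof. by case: a => a /= /asboolP. Qed.

Fact tower1_subproof : finitely_supported (fun=> 0).
Proof. by apply/asboolP; exists 0%N. Qed.
Definition tower1 := Tower tower1_subproof.

Fact tower_mul_subproof (a b : tower) :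
  finitely_supported (fun i => a i + flip (oddz (a i.+1)) (b i)).
Proof.
have [m am] := tower_bound a; have [n bn] := tower_bound b.
apply/asboolP; exists (maxn m n) => i; rewrite geq_max => /andP[mi ni].
by rewrite (am i mi) (bn i ni) /flip oppr0 if_same.
Qed.
Definition tower_mul a b := Tower (tower_mul_subproof a b).

Fact tower_inv_subproof (a : tower) :
  finitely_supported (fun i => - flip (oddz (a i.+1)) (a i)).
Proof.
have [m am] := tower_bound a.
by apply/asboolP; exists m => i mi; rewrite (am i mi) /flip oppr0 if_same oppr0.
Qed.
Definition tower_inv a := Tower (tower_inv_subproof a).

Fact tower_mulA : associative tower_mul.
Proof.
move=> a b c; apply: towerP => i /=; rewrite oddzD oddz_flip /flip.
by case: (oddz (a _)); case: (oddz (b _)) => /=; ring.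
Qed.
Fact tower_mul1g : left_id tower1 tower_mul.
Proof. by move=> a; apply: towerP => i /=; rewrite add0r. Qed.
Fact tower_mulg1 : right_id tower1 tower_mul.
Proof. by move=> a; apply: towerP => i /=; rewrite /flip oppr0 if_same addr0. Qed.
Fact tower_mulVg : left_inverse tower1 tower_inv tower_mul.
Proof.
move=> a; apply: towerP => i /=.
by rewrite oddzN oddz_flip addrC subrr.
Qed.
Fact tower_mulgV : right_inverse tower1 tower_inv tower_mul.
Proof.
move=> a; apply: towerP => i /=; rewrite /flip.
by case: (oddz (a i.+1)); rewrite ?opprK ?subrr// addrC subrr.
Qed.

HB.instance Definition _ := isGroup.Build tower tower_mulA tower_mul1g
  tower_mulg1 tower_mulVg tower_mulgV.

Lemma coordM (a b : tower) i : (a * b)%g i = a i + flip (oddz (a i.+1)) (b i).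
Proof. by []. Qed.
Lemma coord1 i : (1%g : tower) i = 0. Proof. by []. Qed.
Lemma coordV (a : tower) i : (a^-1)%g i = - flip (oddz (a i.+1)) (a i).
Proof. by []. Qed.

Definition chi (a : tower) : bool := oddz (a 0%N).

Lemma chiM a b : chi (a * b)%g = chi a (+) chi b.
Proof. by rewrite /chi coordM oddzD oddz_flip. Qed.
Lemma chi1 : chi 1%g = false. Proof. by []. Qed.
Lemma chiV a : chi (a^-1)%g = chi a.
Proof. by rewrite /chi coordV oddzN oddz_flip. Qed.

Definition even_part : {pred tower} := fun a => ~~ chi a.

Fact even_part1 : 1%g \in even_part. Proof. by []. Qed.
Fact even_partM : mulg_closed even_part.
Proof. by move=> a b; rewrite !unfold_in chiM; case: chi; case: chi. Qed.
Fact even_partV : invg_closed even_part.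
Proof. by move=> a; rewrite !unfold_in chiV. Qed.

HB.instance Definition _ := isMulClosed.Build tower even_part even_partM.
HB.instance Definition _ := isMul1Closed.Build tower even_part even_part1.
HB.instance Definition _ := isInvClosed.Build tower even_part even_partV.

Fact even_part_normal (x y : tower) :
  x \in (even_part : groupClosed tower) ->
  (x ^ y)%g \in (even_part : groupClosed tower).
Proof. by rewrite !unfold_in /conjg !chiM chiV; case: chi; case: chi. Qed.

Definition even_subgroup : normal_subgroup tower := NormalSubgroup even_part_normal.

Lemma even_subgroupE a : (a \in even_subgroup) = ~~ chi a.
Proof. by []. Qed.

Fact base_subproof (k : int) :
  finitely_supported (fun i => if i is 0%N then k else 0).
Proof. by apply/asboolP; exists 1%N => -[]. Qed.
Definition base k := Tower (base_subproof k).

Fact shift_up_subproof (c : int) (a : tower) :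
  finitely_supported (fun i => if i is i'.+1 then a i' else c).
Proof.
have [m am] := tower_bound a; apply/asboolP; exists m.+1 => -[//|i] /=.
by rewrite ltnS => /am.
Qed.

(** The two embeddings of the tower in itself.  They agree on the elements with
    [chi a = false]; for the action x |-> (-1)^(a_1) x + a_0 on the line, their
    images are the stabilizers of the points 0 and 1/2. *)
Definition embed (a : tower) := Tower (shift_up_subproof 0 a).
Definition embed_twist (a : tower) := Tower (shift_up_subproof (chi a) a).

Fact drop_first_subproof (a : tower) : finitely_supported (fun i => a i.+1).
Proof.
have [m am] := tower_bound a; apply/asboolP; exists m => i mi.
by rewrite am// leqW.
Qed.
Definition drop_first (a : tower) := Tower (drop_first_subproof a).

Fact embedM : {morph embed : a b / (a * b)%g}.
Proof.
move=> a b; apply: towerP => -[|i]; rewrite coordM //=.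
by rewrite /flip oppr0 if_same.
Qed.
Fact embed_twistM : {morph embed_twist : a b / (a * b)%g}.
Proof.
move=> a b; apply: towerP => -[|i]; rewrite coordM //= chiM -/(chi a).
by case: (chi a); case: (chi b).
Qed.
Fact drop_firstM : {morph drop_first : a b / (a * b)%g}.
Proof. by move=> a b; apply: towerP => i; rewrite coordM. Qed.
HB.instance Definition _ := isMultiplicative.Build tower tower embed embedM.
HB.instance Definition _ :=
  isMultiplicative.Build tower tower embed_twist embed_twistM.
HB.instance Definition _ :=
  isMultiplicative.Build tower tower drop_first drop_firstM.

Lemma baseD k l : base (k + l) = (base k * base l)%g.
Proof. by apply: towerP => -[|i]; rewrite coordM. Qed.
Lemma base0 : base 0 = 1%g.
Proof. by apply: towerP => -[|i]. Qed.
Lemma baseN k : base (- k) = (base k)^-1%g.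
Proof.
by apply: (mulgI (base k)); rewrite -baseD subrr mulgV base0.
Qed.

Lemma chi_base k : chi (base k) = oddz k. Proof. by []. Qed.
Lemma chi_embed_twist a : chi (embed_twist a) = chi a.
Proof. by rewrite /chi /=; rewrite -/(chi a); case: (chi a). Qed.

(** The decomposition of an element along the semidirect product of the infinite
    cyclic group of the first coordinate and the image of [embed]. *)
Lemma towerE (a : tower) : a = (base (a 0%N) * embed (drop_first a))%g.
Proof.
by apply: towerP => -[|i]; rewrite coordM /= /flip ?add0r ?addr0.
Qed.

Lemma embed_base a k : (embed a * base k = base (flip (chi a) k) * embed a)%g.
Proof.
apply: towerP => -[|i]; rewrite !coordM /=; first by rewrite add0r /flip /= addr0.
by rewrite /flip oppr0 if_same addr0 add0r.
Qed.

Lemma embed_twistE a : embed_twist a = (base (chi a) * embed a)%g.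
Proof.
by apply: towerP => -[|i]; rewrite coordM /= /flip ?add0r ?addr0.
Qed.

Lemma embed_twist_even a : a \in even_subgroup -> embed_twist a = embed a.
Proof. by rewrite even_subgroupE embed_twistE => /negPf ->; rewrite base0 mul1g. Qed.

Lemma embed_twist_inj : injective embed_twist.
Proof.
move=> a b ab; apply: towerP => i; exact: (congr1 (fun c : tower => c i.+1) ab).
Qed.

(** * The subgroup of even elements *)

Lemma left_coset_even a b :
  left_coset even_subgroup a b <-> chi a = chi b.
Proof.
rewrite /left_coset /= even_subgroupE chiM chiV.
by case: (chi a); case: (chi b).
Qed.

Lemma index_even : has_index even_subgroup 2.
Proof.
rewrite /has_index card_eq_sym; apply/card_set_bijP.
exists (fun i : nat => left_coset even_subgroup (base i)); split.
- by move=> i _; exists (base i).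
- move=> i j; rewrite !inE /= => i2 j2 ij.
  have : left_coset even_subgroup (base i) (base j).
    by rewrite ij; apply/left_coset_even.
  move/left_coset_even; rewrite !chi_base /oddz.
  by case: i i2 {ij} => [|[|]]//; case: j j2 => [|[|]].
- move=> _ [a _ <-]; exists (chi a : nat); first by rewrite /=; case: (chi a).
  apply/seteqP; split=> b /left_coset_even ab; apply/left_coset_even; rewrite -ab;
  rewrite chi_base; by case: (chi a).
Qed.

Lemma chiXn a n : chi (a ^+ n)%g = chi a && odd n.
Proof.
elim: n => [|n IHn]; first by rewrite andbF.
by rewrite expgS chiM IHn /=; case: (chi a); case: (odd n).
Qed.

(** An element of odd prime order is even because [chi] is a homomorphism to
    Z/2.  For an involution, an odd coordinate [i] can only cancel in the square
    when coordinate [i.+1] is odd as well, so that the support is infinite. *)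
Lemma moore_condition_even : moore_condition even_subgroup.
Proof.
move=> a l; rewrite even_subgroupE negbK => odd_a pr_l [_ al1 _].
have l2 : l = 2.
  have := congr1 chi al1; rewrite chiXn odd_a chi1 /= => evl.
  by case/even_prime: pr_l => // odl; rewrite odl in evl.
move: al1; rewrite l2 expgS expg1 => aa.
have odd_all i : oddz (a i).
  elim: i => [//|i IHi].
  have := congr1 (fun c : tower => c i) aa; rewrite coordM coord1.
  case: (oddz (a i.+1)) => //= ai0.
  have ai : a i = 0 by move: ai0; lia.
  by rewrite ai in IHi.
have [n an] := tower_bound a.
by have := odd_all n; rewrite an.
Qed.

(** * Powers of the parity class *)

Section SimplicialCochains.
Variable X : Type.
Implicit Types (f g : seq X -> bool) (x : X) (w : seq X).

(** Homogeneous cochains with values in Z/2, of all degrees at once: a function of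
    words, where words of length [n.+1] carry degree [n].  Removing the first
    letter gives recursive forms of the usual alternating sums. *)
Definition after x f : seq X -> bool := fun w => f (x :: w).
Definition addf f g : seq X -> bool := fun w => f w (+) g w.

Fixpoint cobound f w : bool :=
  if w is x :: w' then f w' (+) cobound (after x f) w' else false.

(** The simplicial homotopy between the identity and the map [k] on vertices: the
    sum over [i] of the values at k x_0, ..., k x_i, x_i, ..., x_m. *)
Fixpoint prism (k : X -> X) f w : bool :=
  if w is x :: w' then f (k x :: x :: w') (+) prism k (after (k x) f) w'
  else false.

Lemma coboundD f g w : cobound (addf f g) w = cobound f w (+) cobound g w.
Proof.
elim: w f g => [//|x w IHw] f g /=.
rewrite -[after x (addf f g)]/(addf (after x f) (after x g)) IHw /addf.
by rewrite addbACA.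
Qed.

Lemma prismD k f g w : prism k (addf f g) w = prism k f w (+) prism k g w.
Proof.
elim: w f g => [//|x w IHw] f g /=.
rewrite -[after (k x) (addf f g)]/(addf (after (k x) f) (after (k x) g)) IHw.
by rewrite /addf addbACA.
Qed.

Lemma coboundK f w : cobound (cobound f) w = false.
Proof.
elim: w f => [//|x w IHw] f /=.
have -> : after x (cobound f) = addf f (cobound (after x f)) by [].
by rewrite coboundD IHw addbF addbb.
Qed.

Lemma cobound_prism k f w :
  cobound (prism k f) w (+) prism k (cobound f) w = f w (+) f (map k w).
Proof.
elim: w f => [|x w IHw] f; first by rewrite /= addbb.
rewrite /=.
have -> : after x (prism k f) =
    addf (after x (after (k x) f)) (prism k (after (k x) f)) by [].
have -> : after (k x) (cobound f) = addf f (cobound (after (k x) f)) by [].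
rewrite coboundD prismD; have := IHw (after (k x) f).
move: (cobound (after x _) w) (cobound (prism _ _) w) (prism _ (cobound _) w).
move: (prism k f w); rewrite /after.
case: (f (x :: w)); case: (f (k x :: w)); case: (f (k x :: map k w)) => -[] [] [] [] //=.
Qed.

Variable c : X -> bool.

(** The cup product on the left with the 0-cochain [c]. *)
Definition weight f w := if w is x :: _ then c x && f w else false.

(** The cup product on the left with the coboundary of [c], a 1-cocycle. *)
Definition cup_edge f w :=
  if w is x :: w' then if w' is y :: _ then (c x (+) c y) && f w' else false
  else false.

Definition edge_power n := iter n cup_edge (fun w => size w == 1).

Lemma cobound_scale (b : bool) f w :
  cobound (fun v => b && f v) w = b && cobound f w.
Proof.
elim: w f => [|x w IHw] f /=; first by rewrite andbF.
rewrite -[after x (fun v => b && f v)]/(fun v => b && after x f v) IHw.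
by rewrite andb_addr.
Qed.

(** The Leibniz rule for the product with the 0-cochain [c]. *)
Lemma cobound_weight f w : f [::] = false ->
  cobound (weight f) w = cup_edge f w (+) weight (cobound f) w.
Proof.
case: w => [//|x w] f0 /=.
rewrite -[after x (weight f)]/(fun v => c x && after x f v) cobound_scale.
case: w => [|y w] /=; first by rewrite f0 andbF.
case: (c x); case: (c y); case: (f (y :: w)) => //=.
by rewrite negbK.
Qed.

Lemma cobound_cup_edge f w : f [::] = false ->
  cobound (cup_edge f) w = cup_edge (cobound f) w.
Proof.
move=> f0.
have UE g : g [::] = false ->
    cup_edge g = addf (cobound (weight g)) (weight (cobound g)).
  by move=> g0; apply/funext=> v; rewrite /addf cobound_weight// addbK.
rewrite (UE f)// coboundD coboundK /= cobound_weight//.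
have -> : weight (cobound (cobound f)) w = false.
  by case: w => [//|x w]; rewrite /weight coboundK andbF.
by rewrite addbF.
Qed.

Lemma edge_power_nil n : edge_power n [::] = false.
Proof. by case: n. Qed.

Lemma cobound_edge_power n w : cobound (edge_power n) w = false.
Proof.
elim: n w => [|n IHn] w.
  case: w => [|x [|y w]] //=.
  have nul : forall v g, (forall u, g u = false) -> cobound g v = false.
    elim=> [//|z v IHv] g g0 /=; rewrite g0 IHv// => u; exact: g0.
  rewrite (nul w (after y (after x _))) ?addbF; last by case.
  exact: addbb.
rewrite /edge_power iterS -/(edge_power n) cobound_cup_edge ?edge_power_nil//.
by case: w => [|x [|y w]] //; rewrite /cup_edge IHn andbF.
Qed.

End SimplicialCochains.

Lemma cobound_map (X Y : Type) (h : X -> Y) (f : seq Y -> bool) w :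
  cobound (f \o map h) w = cobound f (map h w).
Proof.
elim: w f => [//|x w IHw] f /=.
by rewrite -[after x (f \o map h)]/(after (h x) f \o map h) IHw.
Qed.

Lemma prism_map (X : Type) (k h : X -> X) (f : seq X -> bool) w :
  (forall x, k (h x) = h (k x)) ->
  prism k (f \o map h) w = prism k f (map h w).
Proof.
move=> kh; elim: w f => [//|x w IHw] f /=; rewrite kh.
by rewrite -[after (k x) (f \o map h)]/(after (h (k x)) f \o map h) IHw.
Qed.

Lemma edge_power_map (X Y : Type) (h : X -> Y) (c : Y -> bool) n w :
  edge_power c n (map h w) = edge_power (c \o h) n w.
Proof.
elim: n w => [|n IHn] [|x [|y w]] //=.
by rewrite -IHn.
Qed.

(** A cochain of the bar complex of [G] is a homogeneous cochain that is invariant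
    under translation. *)
Definition translation_invariant (G : groupType) (f : seq G -> bool) :=
  forall (x : G) w, f (map ( *%g x) w) = f w.

(** The [n]-th power of the class of [chi] vanishes mod 2.  The 1-cocycle of a
    homomorphism to Z/2 is the coboundary of its values on vertices, so its
    power is [edge_power chi n].  The empty word would carry degree -1, which is
    excluded by [f [::] = false]. *)
Definition edge_exact n := exists f : seq tower -> bool,
  [/\ f [::] = false, translation_invariant f &
      forall w, cobound f w = edge_power chi n w].

(** Degree 0 contains no coboundary, and the 0-th power is the constant 1. *)
Lemma edge_exact0 : ~ edge_exact 0.
Proof. by case=> f [f0 _ /(_ [:: 1%g])]; rewrite /= f0. Qed.

(** A retraction of the tower onto the even elements that commutes with left
    translation by them. *)
Definition retract (x : tower) : tower := if chi x then (x * base (-1))%g else x.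

Lemma chi_retract x : chi (retract x) = false.
Proof.
rewrite /retract; case cx: (chi x) => //.
by rewrite chiM cx.
Qed.

Lemma retractM x y : chi x = false -> retract (x * y)%g = (x * retract y)%g.
Proof. by move=> cx; rewrite /retract chiM cx /=; case: (chi y); rewrite ?mulgA. Qed.

Lemma edge_power_false (X : Type) (c : X -> bool) n w :
  (forall x, c x = false) -> edge_power c n.+1 w = false.
Proof. by move=> c0; case: w => [|x [|y w]] //=; rewrite !c0. Qed.

Lemma edge_power_shift (X : Type) (c d : X -> bool) (b : bool) n w :
  (forall x, c x = b (+) d x) -> edge_power c n w = edge_power d n w.
Proof.
move=> cd; elim: n w => [//|n IHn] [|x [|y w]] //=.
by rewrite IHn !cd addbACA addbb.
Qed.

(** The descent.  Pulling back a primitive of the (n+1)-st power along both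
    embeddings gives a primitive [F] that vanishes on even elements; subtracting
    the obvious primitive over the even subgroup leaves a cocycle [z] that
    vanishes there too, hence has a primitive [p] over the even subgroup.  The
    sum of [p] and its translate by an odd element is then a primitive of the
    [n]-th power. *)
Lemma edge_exactS n : edge_exact n.+1 -> edge_exact n.
Proof.
case=> f [f0 f_inv df].
pose F := addf (f \o map embed) (f \o map embed_twist).
have dF w : cobound F w = edge_power chi n.+1 w.
  rewrite coboundD !cobound_map !df !edge_power_map edge_power_false// addFb.
  by congr (edge_power _ _ _); apply/funext => x /=; rewrite chi_embed_twist.
have F_inv : translation_invariant F.
  move=> x w; rewrite /F /addf /=; congr (_ (+) _).
    rewrite -[RHS](f_inv (embed x)) -!map_comp.
    by congr f; apply: eq_map => y /=; rewrite gmulfM.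
  rewrite -[RHS](f_inv (embed_twist x)) -!map_comp.
  by congr f; apply: eq_map => y /=; rewrite gmulfM.
have F_even w : (forall x, x \in w -> chi x = false) -> F w = false.
  move=> ev; rewrite /F /addf /=.
  suff -> : map embed_twist w = map embed w by rewrite addbb.
  by apply/eq_in_map => x /ev cx; apply: embed_twist_even; rewrite even_subgroupE cx.
pose z := addf F (weight chi (edge_power chi n)).
have dz w : cobound z w = false.
  rewrite coboundD dF cobound_weight ?edge_power_nil//.
  have -> : weight chi (cobound (edge_power chi n)) w = false.
    by case: w => [//|x w]; rewrite /weight cobound_edge_power andbF.
  by rewrite addbF addbb.
have z_even w : z (map retract w) = false.
  rewrite /z /addf F_even; last by move=> _ /mapP[x _ ->]; exact: chi_retract.
  by case: w => [//|x w] /=; rewrite chi_retract.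
have z_inv x w : chi x = false -> z (map ( *%g x) w) = z w.
  move=> cx; rewrite /z /addf F_inv; congr (_ (+) _).
  case: w => [//|y w].
  rewrite -[LHS]/(chi (x * y)%g && edge_power chi n (map ( *%g x) (y :: w))).
  rewrite chiM cx edge_power_map (@edge_power_shift _ _ chi false)// => y'.
  by rewrite /= chiM cx.
pose p := prism retract z.
(* [z] is null on the image of [retract], which is homotopic to the identity. *)
have dp w : cobound p w = z w.
  have := cobound_prism retract z w; rewrite z_even addbF => <-.
  suff -> : prism retract (cobound z) w = false by rewrite addbF.
  have -> : cobound z = (fun=> false) by apply/funext.
  by elim: w => [//|x w IHw] /=; rewrite -[after _ _]/(fun=> false).
have p_inv x w : chi x = false -> p (map ( *%g x) w) = p w.
  move=> cx; rewrite /p -(@prism_map _ retract ( *%g x)).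
    by congr prism; apply/funext=> v /=; rewrite z_inv.
  by move=> y; rewrite retractM.
(* The transfer from the even subgroup of index 2, with coset representatives
   [1] and [base 1]. *)
exists (addf p (p \o map ( *%g (base 1)))); split.
- by rewrite /addf /p.
- move=> x w; rewrite /addf /=.
  case cx: (chi x).
    rewrite addbC; congr (_ (+) _).
      rewrite -(p_inv (base 1 * x)%g w) ?chiM ?cx//.
      by congr p; rewrite -map_comp; apply: eq_map => y /=; rewrite mulgA.
    rewrite -(p_inv (base 1 * x^-1)%g) ?chiM ?chiV ?cx//.
    by congr p; rewrite -!map_comp; apply: eq_map => y /=; rewrite mulgA mulgVK.
  rewrite p_inv//; congr (_ (+) _).
  rewrite -(p_inv (base 1 * x^-1 * (base 1)^-1)%g) ?chiM ?chiV ?cx//.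
  by congr p; rewrite -!map_comp; apply: eq_map => y /=; rewrite !mulgA !mulgVK.
- move=> w; rewrite coboundD cobound_map !dp /z /addf F_inv.
  rewrite addbACA addbb /=.
  case: w => [|x w]; first by rewrite /= edge_power_nil.
  rewrite -[weight _ _ (map _ _)]/(chi (base 1 * x)%g &&
      edge_power chi n (map ( *%g (base 1)) (x :: w))).
  rewrite edge_power_map (@edge_power_shift _ _ chi true); last first.
    by move=> y /=; rewrite chiM.
  by rewrite chiM /weight; case: (chi x); case: edge_power.
Qed.

Lemma not_edge_exact n : ~ edge_exact n.
Proof. by elim: n => [|n IHn]; [exact: edge_exact0 | move/edge_exactS]. Qed.

(** * The Bockstein *)

Section Homogenization.
Variable G : groupType.
Implicit Types (f : cochain G) (x y : G) (w : seq G).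

(** The passage from homogeneous to inhomogeneous words: the bar word of
    x_0, ..., x_m is x_0^-1 x_1, ..., x_(m-1)^-1 x_m. *)
Fixpoint increments x w :=
  if w is y :: w' then (x^-1 * y)%g :: increments y w' else [::].

Definition homogenize f w : bool :=
  if w is x :: w' then oddz (f (increments x w')) else false.

Lemma increments_mul z x w : increments (z * x)%g (map ( *%g z) w) = increments x w.
Proof.
elim: w x => [//|y w IHw] x /=.
by rewrite IHw invgM mulgA mulgVK.
Qed.

Lemma homogenize_invariant f : translation_invariant (homogenize f).
Proof. by move=> z [//|x w] /=; rewrite increments_mul. Qed.

Lemma cobound_after_homogenize f x y w :
  cobound (after x (homogenize f)) (y :: w) =
  oddz (tail_diff (x^-1 * y)%g (increments y w) f).
Proof.
elim: w f x y => [|z w IHw] f x y; first by rewrite /= addbF.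
rewrite [LHS]/=.
rewrite -[after y (after x _)]/(after y (homogenize (Defs.shift (x^-1 * y)%g f))).
have := IHw (Defs.shift (x^-1 * y)%g f) y z; rewrite [LHS]/= => ->.
by rewrite [in RHS]/= oddzD oddzN mulgA mulgK.
Qed.

Lemma cobound_homogenize f x w :
  cobound (homogenize f) (x :: w) = oddz (codiff f (increments x w)).
Proof.
case: w => [//|y w].
rewrite [LHS]/= -[X in _ (+) X]/(cobound (after x (homogenize f)) (y :: w)).
by rewrite cobound_after_homogenize [increments x _]/= codiff_cons oddzD oddzN.
Qed.

End Homogenization.

(** The parity, with values 0 and 1 in the integers.  It is a cocycle only mod 2,
    but its square is an integral cocycle, cohomologous to the Bockstein. *)
Definition chi_cochain : cochain tower :=
  fun w => if w is [:: x] then (chi x : nat)%:Z else 0.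

Lemma chi_cochainM_nil (f : cochain tower) : (chi_cochain * f) [::] = 0.
Proof. by rewrite -[LHS]/(cup chi_cochain f [::]) cup_nil mul0r. Qed.

Lemma chi_cochainM (f : cochain tower) x w :
  (chi_cochain * f) (x :: w) = (chi x : nat)%:Z * f w.
Proof.
rewrite -[LHS]/(cup chi_cochain f (x :: w)) cup_cons mul0r add0r.
have -> : Defs.shift x chi_cochain = (fun v => (chi x : nat)%:Z * cochain_one v).
  by apply/funext => -[|y v]; rewrite /Defs.shift /cochain_one /= ?mulr1// mulr0.
by rewrite cupZl cup1l.
Qed.

Lemma homogenize_chiX n :
  homogenize (chi_cochain ^+ n) = edge_power chi n.
Proof.
apply/funext; elim: n => [|n IHn] [|x [|y w]] //.
  by rewrite exprS [LHS]/= chi_cochainM_nil.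
rewrite exprS [LHS]/= chi_cochainM.
rewrite -[RHS]/((chi x (+) chi y) && edge_power chi n (y :: w)) -IHn.
rewrite chiM chiV /homogenize.
by case: (_ (+) _); rewrite ?mul1r ?mul0r.
Qed.

Lemma chi_power_not_coboundary n (f : cochain tower) : chi_cochain ^+ n <> codiff f.
Proof.
move=> nf; apply: (@not_edge_exact n); exists (homogenize f); split=> //.
  exact: homogenize_invariant.
case=> [|x w]; first by rewrite edge_power_nil.
by rewrite cobound_homogenize -nf -homogenize_chiX.
Qed.

Lemma tail_diff_const0 (G : groupType) (x : G) w : tail_diff x w (fun=> 0) = 0.
Proof.
elim: w x => [//|y w IHw] x /=.
by rewrite -[Defs.shift x (fun=> 0)]/(fun=> 0) IHw subrr.
Qed.

Lemma codiff_chi : codiff chi_cochain = chi_cochain ^+ 2 *+ 2.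
Proof.
apply/funext => -[|x w]; rewrite expr2 mulr2n cochainD.
  by rewrite chi_cochainM_nil.
rewrite chi_cochainM codiff_cons.
case: w => [|y [|z w]] /=.
- by rewrite mulr0 addr0.
- by rewrite /Defs.shift /= chiM; case: (chi x); case: (chi y).
- rewrite mulr0 addr0 sub0r.
  by rewrite /Defs.shift /= tail_diff_const0 subrr oppr0.
Qed.

(** Both terms of the Leibniz rule equal twice the cube of [chi_cochain], with
    opposite signs. *)
Lemma codiff_chi2 : codiff (chi_cochain ^+ 2) = 0.
Proof.
have par : parity chi_cochain = - chi_cochain.
  apply/funext => -[|x [|y w]]; rewrite cochainN /parity /= ?mulr0 ?oppr0//.
  by rewrite expr1 mulN1r.
rewrite [in LHS]expr2 codiffM par codiff_chi mulNr mulrnAl mulrnAr.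
by rewrite -exprS -exprSr subrr.
Qed.

Lemma chi2_cocycle : chi_cochain ^+ 2 \in is_cocycle (G := tower).
Proof.
apply/asboolP; split; last exact: codiff_chi2.
exists 2%N => -[|x [|y [|z w]]]// _; rewrite expr2 chi_cochainM.
by rewrite /chi_cochain mulr0.
Qed.

Section Bockstein.
Variable q : Z_extension 2 (quotient_group even_subgroup).
Local Open Scope quotient_scope.

(** The section of the extension by the integers that defines the class of the
    extension, read on the tower: an integer with the parity of [chi x]. *)
Definition lift_coset (x : tower) : int := ext_section q (quotient_map even_subgroup x).

Lemma quotient_map_eq1 x : quotient_map even_subgroup x = 1%g <-> chi x = false.
Proof.
have -> : 1%g = quotient_map even_subgroup 1%g.
  apply: (mulgI (quotient_map even_subgroup 1%g)).
  by rewrite -quotient_mapM !mulg1.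
have h : (quotient_map even_subgroup x == quotient_map even_subgroup 1%g) = ~~ chi x.
  rewrite -chiV -[(x^-1)%g]mulg1 -[RHS]/(same_coset even_subgroup x 1%g).
  exact: same_cosetE.
by split=> [/eqP|cx]; [rewrite h => /negPf | apply/eqP; rewrite h cx].
Qed.

Lemma oddz_lift_coset x : oddz (lift_coset x) = chi x.
Proof.
have : q (lift_coset x) = 1%g <-> chi x = false.
  by rewrite /lift_coset ext_sectionK; exact: quotient_map_eq1.
rewrite ext_proj_ker => h.
have : (2 %| lift_coset x)%Z = ~~ oddz (lift_coset x) by rewrite /oddz; lia.
move: h; case: (chi x) => -[h1 h2]; case: oddz => // e.
  by have := h1 e.
by have := h2 erefl; rewrite e.
Qed.

Definition bockstein_cocycle : cocycle tower :=
  pullback_cocycle (quotient_map even_subgroup)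
    (Cocycle (ext_cochain_is_cocycle q)).

(** The difference of the sections [lift_coset] and [chi], divided by 2. *)
Definition carry : cochain tower :=
  fun w => if w is [:: x] then (lift_coset x %/ 2)%Z else 0.

(** The section with values 0 and 1 has factor set chi(x) chi(y), because
    chi(x) + chi(y) - chi(xy) = 2 chi(x) chi(y) for integers 0 and 1; changing
    the section changes the factor set by a coboundary. *)
Lemma bockstein_cocycleE :
  cocycle_val bockstein_cocycle = chi_cochain ^+ 2 + codiff carry.
Proof.
apply/funext => -[|x w]; rewrite cochainD expr2.
  by rewrite chi_cochainM_nil addr0.
rewrite chi_cochainM codiff_cons.
case: w => [|y [|z w]].
- by rewrite /= mulr0 subrr.
- rewrite /= /Defs.shift /pullback /=.
  apply: (@mulIf _ 2) => //.
  have := ext_factorE q (quotient_map even_subgroup x) (quotient_map even_subgroup y).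
  rewrite -gmulfM -!/(lift_coset _) => ->.
  move: (oddz_lift_coset x) (oddz_lift_coset y) (oddz_lift_coset (x * y)%g).
  rewrite chiM; case: (chi x); case: (chi y) => /=; rewrite /oddz; lia.
- by rewrite /= /pullback /Defs.shift /= tail_diff_const0 mulr0 !subr0.
Qed.

Lemma bockstein_powerE n : exists f : cochain tower,
  cocycle_val (bockstein_cocycle ^+ n) = (chi_cochain ^+ 2) ^+ n - codiff f.
Proof.
have [_ dB] := cocycleP bockstein_cocycle.
have dX m : codiff ((chi_cochain ^+ 2) ^+ m) = 0.
  by have /asboolP[] := rpredX m chi2_cocycle.
elim: n => [|n [f IHn]].
  exists (0 - 0); rewrite !expr0 codiffB subrr subr0.
  by [].
set B := bockstein_cocycle in dB IHn *; pose X := chi_cochain ^+ 2.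
exists (parity (cocycle_val B) * f - carry * X ^+ n).
rewrite exprS -[LHS]/(cocycle_val B * cocycle_val (B ^+ n)) IHn mulrBr.
rewrite codiffB !codiffM codiff_parity dB dX parityK mulr0 addr0.
have -> : parity (0 : cochain tower) = 0.
  by apply/funext => w; rewrite /parity mulr0.
rewrite oppr0 mul0r add0r opprB addrA; congr (_ - _).
by rewrite bockstein_cocycleE -/X mulrDl exprS.
Qed.

Lemma bockstein_not_nilpotent : ~ nilpotent (bockstein q).
Proof.
rewrite /bockstein /ext_class inflation_class -/bockstein_cocycle.
have classX n : cohomology_class bockstein_cocycle ^+ n =
    cohomology_class (bockstein_cocycle ^+ n).
  elim: n => [|n IHn]; first by rewrite !expr0 /cohomology_class !piE.
  by rewrite !exprS IHn /cohomology_class !piE.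
case=> n; rewrite classX => /eqP.
have -> : 0 = cohomology_class (0 : cocycle tower).
  by rewrite /cohomology_class !piE.
rewrite /cohomology_class.
rewrite cohomology_eq subr0 => /asboolP[g _].
have [f ->] := bockstein_powerE n; rewrite -exprM => Xg.
apply: (@chi_power_not_coboundary (2 * n) (g - (g - g - f))).
by rewrite !codiffB subrr sub0r opprK -Xg subrK.
Qed.

End Bockstein.

(** * Projective modules and subgroups *)

Lemma mult_one (G K : groupType) (h : {multiplicative G -> K}) : h 1%g = 1%g.
Proof. by apply: (mulgI (h 1%g)); rewrite -gmulfM !mulg1. Qed.

Lemma mult_inv (G K : groupType) (h : {multiplicative G -> K}) x :
  h (x^-1)%g = (h x)^-1%g.
Proof. by apply: (mulgI (h x)); rewrite -gmulfM !mulgV mult_one. Qed.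

Section PulledBackModule.
Variables (G K : groupType) (h : {multiplicative G -> K}) (N : gmodule K).

Definition pull_gact (x : G) (n : N) : N := gact (h x) n.

Fact pull_gact1 n : pull_gact 1%g n = n.
Proof. by rewrite /pull_gact mult_one gact1. Qed.
Fact pull_gactM x y n : pull_gact (x * y)%g n = pull_gact x (pull_gact y n).
Proof. by rewrite /pull_gact gmulfM gactM. Qed.
Fact pull_gactD x m n : pull_gact x (m + n) = pull_gact x m + pull_gact x n.
Proof. exact: gactD. Qed.

Definition pull : gmodule G := GModule pull_gact1 pull_gactM pull_gactD.

End PulledBackModule.

Section Coinduction.
Variables (G K : groupType) (h : {multiplicative G -> K}) (A : gmodule G).

(** The coinduced module: the functions on [K] that are equivariant along [h],
    on which [K] acts by right translation. *)
Definition equivariant : {pred K -> A} :=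
  fun f => `[< forall x y, f (h x * y)%g = gact x (f y) >].

Lemma gact0 x : gact x (0 : A) = 0.
Proof. by apply: (addrI (gact x 0)); rewrite -gactD !addr0. Qed.

Lemma gactN x (m : A) : gact x (- m) = - gact x m.
Proof. by apply: (addrI (gact x m)); rewrite -gactD !subrr gact0. Qed.

Fact equivariant_closed : zmod_closed equivariant.
Proof.
split; first by apply/asboolP => x y; rewrite gact0.
move=> f g /asboolP ef /asboolP eg; apply/asboolP => x y.
rewrite -[(f - g) _]/(f (h x * y)%g - g (h x * y)%g) ef eg.
by rewrite -gactN -gactD.
Qed.

HB.instance Definition _ := GRing.isZmodClosed.Build (K -> A) equivariant
  equivariant_closed.

Record coind_type := Coind { coind_val :> K -> A; _ : equivariant coind_val }.

HB.instance Definition _ := [isSub for coind_val].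
HB.instance Definition _ := [Choice of coind_type by <:].
HB.instance Definition _ := [SubChoice_isSubZmodule of coind_type by <:].

Lemma coindP (f : coind_type) x y : f (h x * y)%g = gact x (f y).
Proof. by case: f => f /= /asboolP. Qed.

Lemma coind_ext (f g : coind_type) : (forall y, f y = g y) -> f = g.
Proof. by move=> fg; apply: val_inj; apply/funext. Qed.

Fact coind_act_subproof z (f : coind_type) : equivariant (fun y => f (y * z)%g).
Proof. by apply/asboolP => x y; rewrite -mulgA coindP. Qed.

Definition coind_act z f := Coind (coind_act_subproof z f).

Fact coind_act1 f : coind_act 1%g f = f.
Proof. by apply: coind_ext => y /=; rewrite mulg1. Qed.
Fact coind_actM x z f : coind_act (x * z)%g f = coind_act x (coind_act z f).
Proof. by apply: coind_ext => y /=; rewrite mulgA. Qed.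
Fact coind_actD x f g : coind_act x (f + g) = coind_act x f + coind_act x g.
Proof. exact: coind_ext. Qed.

Definition coind : gmodule K := GModule coind_act1 coind_actM coind_actD.

End Coinduction.

(** The image of [h] acts freely on [K] by left translation, so equivariant
    functions are freely prescribed on orbit representatives. *)
Lemma coind_surjective (G K : groupType) (h : {multiplicative G -> K})
    (A B : gmodule G) (g : A -> B) :
  injective h -> gmodule_hom g -> (forall n, exists m, g m = n) ->
  forall f : coind h B, exists f' : coind h A, forall y, g (f' y) = f y.
Proof.
move=> h_inj [gD gM] g_surj f.
pose orb (y : K) := [set z | exists x, y = (h x * z)%g]%classic.
pose rep y := xget 1%g (orb y).
have rep_ex y : exists x, y = (h x * rep y)%g.
  by apply: (@xgetPex _ 1%g (orb y)); exists y, 1%g; rewrite mult_one mul1g.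
have repM x y : rep (h x * y)%g = rep y.
  congr xget; apply/seteqP; split=> z [t yE].
    by exists (x^-1 * t)%g; rewrite gmulfM mult_inv -mulgA -yE mulKg.
  by exists (x * t)%g; rewrite gmulfM -mulgA -yE.
pose s y := sval (cid (rep_ex y)).
have sE y : y = (h (s y) * rep y)%g := svalP (cid (rep_ex y)).
have sM x y : s (h x * y)%g = (x * s y)%g.
  apply: h_inj; apply: (mulIg (rep y)).
  by rewrite -{1}(repM x y) -sE gmulfM -mulgA -sE.
pose a n := sval (cid (g_surj n)).
have aE n : g (a n) = n := svalP (cid (g_surj n)).
have f'_eq : equivariant h (fun y => gact (s y) (a (f (rep y)))).
  by apply/asboolP => x y; rewrite sM repM gactM.
by exists (Coind f'_eq) => y; rewrite /= gM aE -(coindP f) -sE.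
Qed.

(** Restriction along an injective homomorphism is left adjoint to coinduction,
    which preserves surjections. *)
Lemma projective_pull (G K : groupType) (h : {multiplicative G -> K})
    (N : gmodule K) :
  injective h -> projective_gmodule N -> projective_gmodule (pull h N).
Proof.
move=> h_inj projN A B g f g_hom g_surj [fD fM].
have F_eq (n : N) : equivariant (A := B) h (fun y => f (gact y n)).
  by apply/asboolP => x y; rewrite gactM -fM.
pose F n : coind h B := Coind (F_eq n).
have gE (e : coind h A) : equivariant (A := B) h (fun y => g (e y)).
  by apply/asboolP => x y; rewrite coindP (proj2 g_hom).
pose g' e : coind h B := Coind (gE e).
have [|||l [lD lM] lE] := projN (coind h A) (coind h B) g' F.
- split=> [d e|x e]; apply: coind_ext => y //=; last first.
  exact: (proj1 g_hom).
- move=> e; have [e' e'E] := coind_surjective h_inj g_hom g_surj e.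
  by exists e'; apply: coind_ext.
- split=> [m n|x n]; apply: coind_ext => y /=; first by rewrite gactD fD.
  by rewrite gactM.
exists (fun n => l n 1%g).
  split=> [m n|x n]; first by rewrite lD.
  rewrite -[gact x n]/(gact (h x) n) lM /= mul1g.
  by rewrite -[h x]mulg1 coindP.
by move=> n; rewrite -[LHS]/(g' (l n) 1%g) lE /= gact1.
Qed.

(** Projectivity moves along isomorphisms; the uses are with identity maps,
    between two presentations of the same action. *)
Lemma projective_iso (G : groupType) (M N : gmodule G) (i : M -> N) (j : N -> M) :
  gmodule_hom i -> gmodule_hom j -> cancel j i ->
  projective_gmodule M -> projective_gmodule N.
Proof.
move=> [iD iM] [jD jM] jK projM A B g f g_hom g_surj [fD fM].
have [|l [lD lM] lE] := projM A B g (f \o i) g_hom g_surj.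
  by split=> [m n|x m] /=; rewrite ?iD ?iM ?fD ?fM.
exists (l \o j); first by split=> [m n|x m] /=; rewrite ?jD ?jM ?lD ?lM.
by move=> n; rewrite /= lE /= jK.
Qed.

(** * Derivations into the endomorphisms of a projective module *)

Definition additive_map (V W : zmodType) (f : V -> W) :=
  forall m n, f (m + n) = f m + f n.

Section Conjugation.
Variables (G : groupType) (M : gmodule G).
Implicit Types (x y : G) (f g : M -> M).

Definition conjf x f : M -> M := fun m => gact x (f (gact x^-1%g m)).

Lemma gactK x : cancel (gact (g := M) x) (gact x^-1%g).
Proof. by move=> m; rewrite -gactM mulVg gact1. Qed.

Lemma gactVK x : cancel (gact (g := M) x^-1%g) (gact x).
Proof. by move=> m; rewrite -gactM mulgV gact1. Qed.

Lemma conjf1 f : conjf 1%g f = f.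
Proof. by apply/funext => m; rewrite /conjf invg1 !gact1. Qed.

Lemma conjfM x y f : conjf (x * y)%g f = conjf x (conjf y f).
Proof. by apply/funext => m; rewrite /conjf invgM !gactM. Qed.

Lemma conjfD x f g : conjf x (f + g) = conjf x f + conjf x g.
Proof. by apply/funext => m; exact: gactD. Qed.

Lemma conjf0 x : conjf x 0 = 0.
Proof. by apply/funext => m; exact: gact0. Qed.

Lemma conjfN x f : conjf x (- f) = - conjf x f.
Proof. by apply/funext => m; exact: gactN. Qed.

Lemma conjfB x f g : conjf x (f - g) = conjf x f - conjf x g.
Proof. by rewrite conjfD conjfN. Qed.

Lemma conjf_id x : conjf x id = id.
Proof. by apply/funext => m; rewrite /conjf gactVK. Qed.

Lemma conjf_comp x f g : conjf x (f \o g) = conjf x f \o conjf x g.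
Proof. by apply/funext => m; rewrite /conjf /= gactK. Qed.

Lemma additive_conjf x f : additive_map f -> additive_map (conjf x f).
Proof. by move=> fD m n; rewrite /conjf gactD fD gactD. Qed.

(** Derivations from [S] to the group of endomorphisms of [M], with the
    conjugation action. *)
Definition derivation_on (S : {pred G}) (d : G -> M -> M) :=
  (forall x, x \in S -> additive_map (d x)) /\
  (forall x y, x \in S -> y \in S -> d (x * y)%g = d x + conjf x (d y)).

End Conjugation.

Lemma additiveD (V W : zmodType) (f g : V -> W) :
  additive_map f -> additive_map g -> additive_map (f + g).
Proof.
move=> fD gD m n; rewrite -[LHS]/(f (m + n) + g (m + n)) fD gD.
by rewrite -[RHS]/(f m + g m + (f n + g n)) addrACA.
Qed.

Lemma additiveN (V W : zmodType) (f : V -> W) :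
  additive_map f -> additive_map (- f).
Proof.
move=> fD m n; rewrite -[LHS]/(- f (m + n)) fD.
by rewrite opprD.
Qed.

(** A derivation [d] is the same as an extension of [M] by itself that is split as
    an extension of abelian groups; a splitting of modules writes [d] as an inner
    derivation. *)
Section TwistedExtension.
Variables (G : groupType) (M : gmodule G) (d : G -> M -> M).
Hypothesis d_add : forall x, additive_map (d x).
Hypothesis d_der : forall x y, d (x * y)%g = d x + conjf x (d y).

Definition twisted_gact (x : G) (u : M * M) : M * M :=
  (gact x u.1 + d x (gact x u.2), gact x u.2).

Fact twisted_gact1 u : twisted_gact 1%g u = u.
Proof.
have d1 : d 1%g = 0.
  have := d_der 1%g 1%g; rewrite mulg1 conjf1 => d11.
  by apply: (addrI (d 1%g)); rewrite addr0 -d11.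
by case: u => u v; rewrite /twisted_gact d1 /= !gact1 addr0.
Qed.
Fact twisted_gactM x y u : twisted_gact (x * y)%g u = twisted_gact x (twisted_gact y u).
Proof.
rewrite /twisted_gact d_der /= !gactM gactD; congr (_, _).
rewrite -[(d x + conjf x (d y)) _]/(d x _ + conjf x (d y) _) /conjf gactK.
by rewrite [d x _ + _]addrC addrA.
Qed.
Fact twisted_gactD x u v : twisted_gact x (u + v) = twisted_gact x u + twisted_gact x v.
Proof. by rewrite /twisted_gact /= !gactD d_add; congr (_, _); rewrite addrACA. Qed.

Definition twisted_extension : gmodule G :=
  GModule twisted_gact1 twisted_gactM twisted_gactD.

Lemma projective_derivation_inner : projective_gmodule M ->
  exists2 f : M -> M, additive_map f & forall x, d x = f - conjf x f.
Proof.
move=> projM.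
have [|m||l [lD lM] lE] := projM twisted_extension M (fun u : M * M => u.2) id.
- by split.
- by exists (0, m).
- by split.
exists (fun m => (l m).1) => [m n|x]; first by rewrite lD.
apply/funext => m; rewrite -[RHS]/((l m).1 - gact x (l (gact x^-1%g m)).1).
have := congr1 fst (lM x (gact x^-1%g m)).
rewrite gactVK /= lE gactVK => ->.
by rewrite addrC addKr.
Qed.

End TwistedExtension.

Section Inclusion.
Variables (G : groupType) (S H : groupClosed G) (SH : {subset S <= H}).

Fact inclusion_subproof (x : subgroup_type S) : sg_val x \in H.
Proof. by case: x => x /= /SH. Qed.
Definition inclusion x : subgroup_type H := SubgroupElt (inclusion_subproof x).

Fact inclusionM : {morph inclusion : x y / (x * y)%g}.
Proof. by move=> x y; apply: val_inj. Qed.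
HB.instance Definition _ := isMultiplicative.Build
  (subgroup_type S) (subgroup_type H) inclusion inclusionM.

Lemma inclusion_inj : injective inclusion.
Proof. by move=> x y /(congr1 val) xy; apply: val_inj. Qed.

Lemma projective_res (M : gmodule G) :
  projective_gmodule (res_gmodule H M) -> projective_gmodule (res_gmodule S M).
Proof.
move/(projective_pull inclusion_inj).
by apply: (@projective_iso _ (pull inclusion (res_gmodule H M)) (res_gmodule S M) id id).
Qed.

(** The first cohomology of [S] with values in the endomorphisms of [M] vanishes
    when [M] is projective over a group that contains [S]. *)
Lemma derivation_on_inner (M : gmodule G) (d : G -> M -> M) :
  projective_gmodule (res_gmodule H M) -> derivation_on S d ->
  exists2 f : M -> M, additive_map f & forall x, x \in S -> d x = f - conjf x f.
Proof.
move=> /projective_res projM [d_add d_der].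
have [||f f_add fE] := @projective_derivation_inner _ (res_gmodule S M)
  (fun x => d (sg_val x)) _ _ projM.
- by move=> [x xS]; apply: d_add.
- by move=> [x xS] [y yS]; apply: d_der.
by exists f => // x xS; apply: (fE (SubgroupElt xS)).
Qed.

End Inclusion.

(** * Moore's conjecture for the tower *)

Definition below n : {pred tower} := fun a => `[< forall i, (n <= i)%N -> a i = 0 >].

Lemma belowP n (a : tower) : reflect (forall i, (n <= i)%N -> a i = 0) (a \in below n).
Proof. exact: asboolP. Qed.

Section Below.
Variable n : nat.

Fact below1 : 1%g \in below n. Proof. exact/belowP. Qed.
Fact belowM : mulg_closed (below n).
Proof.
move=> a b /belowP an /belowP bn; apply/belowP => i ni.
by rewrite coordM an// bn// /flip oppr0 if_same.
Qed.
Fact belowV : invg_closed (below n).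
Proof.
move=> a /belowP an; apply/belowP => i ni.
by rewrite coordV (an i ni) /flip oppr0 if_same oppr0.
Qed.
HB.instance Definition _ := isMulClosed.Build tower (below n) belowM.
HB.instance Definition _ := isMul1Closed.Build tower (below n) below1.
HB.instance Definition _ := isInvClosed.Build tower (below n) belowV.

Definition even_below : {pred tower} := fun a => (a \in below n) && ~~ chi a.

Lemma even_belowP a : (a \in even_below) = (a \in below n) && ~~ chi a.
Proof. by []. Qed.

Fact even_below1 : 1%g \in even_below. Proof. by rewrite even_belowP below1. Qed.
Fact even_belowM : mulg_closed even_below.
Proof.
move=> a b; rewrite !even_belowP => /andP[an ea] /andP[bn eb].
by rewrite belowM// chiM (negPf ea) (negPf eb).
Qed.
Fact even_belowV : invg_closed even_below.
Proof.
by move=> a; rewrite !even_belowP chiV => /andP[an ea]; rewrite belowV.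
Qed.
HB.instance Definition _ := isMulClosed.Build tower even_below even_belowM.
HB.instance Definition _ := isMul1Closed.Build tower even_below even_below1.
HB.instance Definition _ := isInvClosed.Build tower even_below even_belowV.

Lemma even_below_sub : {subset even_below <= even_subgroup}.
Proof. by move=> a; rewrite even_belowP even_subgroupE => /andP[]. Qed.

End Below.

Lemma below_base n k : base k \in below n.+1.
Proof. by apply/belowP => -[]. Qed.

Lemma even_below_base n k : base (2 * k) \in even_below n.+1.
Proof. by rewrite even_belowP below_base chi_base /oddz; lia. Qed.

Lemma below_drop_first n a : a \in below n.+1 -> drop_first a \in below n.
Proof. by move=> /belowP an; apply/belowP => i ni /=; apply: an. Qed.

Lemma below_embed n a : a \in below n -> embed a \in below n.+1.
Proof. by move=> /belowP an; apply/belowP => -[//|i]; rewrite ltnS; apply: an. Qed.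

Lemma even_below_embed n a : a \in below n -> embed a \in even_below n.+1.
Proof. by move=> /below_embed an; rewrite even_belowP an. Qed.

Lemma even_below_conj n a :
  a \in even_below n.+1 -> (a ^ base 1)%g \in even_below n.+1.
Proof.
rewrite !even_belowP => /andP[an ea]; apply/andP; split.
  by rewrite gpredJ ?below_base.
by rewrite /conjg !chiM chiV (negPf ea).
Qed.

Lemma int_step_ind (P : int -> Prop) :
  P 0 -> (forall k, P k <-> P (k + 1)) -> forall k, P k.
Proof.
move=> P0 PS [n|n].
  by elim: n => [//|n /PS]; rewrite -addn1 PoszD.
have := PS (Negz n); elim: n => [|n IHn]; first by case=> _; apply.
case=> _; apply; have := IHn (PS _); rewrite !NegzE.
by congr P; lia.
Qed.

(** The unique solution with [F 0 = 0]; for negative arguments it is the opposite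
    of a sum over the integers from [k] to [-1]. *)
Lemma exists_antidifference (V : zmodType) (f : int -> V) :
  exists F : int -> V, F 0 = 0 /\ forall k, F (k + 1) = F k + f k.
Proof.
exists (fun k : int => match k with
  | Posz n => \sum_(i < n) f i | Negz n => - \sum_(i < n.+1) f (Negz i) end).
split; first exact: big_ord0.
case=> [n|[|n]].
- by rewrite -PoszD addn1; exact: big_ord_recr.
- by rewrite [in RHS]big_ord_recr big_ord0 /= add0r addNr; exact: big_ord0.
- have -> : Negz n.+1 + 1 = Negz n by rewrite !NegzE; lia.
  by rewrite [in RHS]big_ord_recr /= opprD addrNK.
Qed.

(** A half trace is an endomorphism over the even elements whose trace to the
    whole group is the identity. *)
Definition half_trace (M : gmodule tower) n (f : M -> M) :=
  [/\ additive_map f, forall x, x \in even_below n -> conjf x f = f &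
      f + conjf (base 1) f = id].

(** The even subgroup is here infinite cyclic, generated by [base 2].  The
    derivation sending [base 2] to [id] is inner, so [id = f - t f] where [t] is
    conjugation by [base 2], the square of conjugation [s] by [base 1].  Since
    1 - s^2 = (1 + s)(1 - s), the function [f - s f] is a half trace. *)
Lemma half_trace1 (M : gmodule tower) :
  projective_gmodule (res_gmodule even_subgroup M) -> exists f, @half_trace M 1 f.
Proof.
move=> projM.
pose d (x : tower) (m : M) : M := m *~ (x 0%N %/ 2)%Z.
have conj_d x y : conjf x (d y) = d y.
  apply/funext => m; rewrite /conjf /d -[in RHS](gactVK x m).
  elim/int_step_ind: (y 0%N %/ 2)%Z => [|k]; first by rewrite !mulr0z gact0.
  rewrite !mulrzDr !mulr1z gactD; split=> [-> //|].
  by move/addIr.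
have even_below1P x : x \in even_below 1 -> x = base (2 * (x 0%N %/ 2)%Z).
  rewrite even_belowP => /andP[/belowP x1 ex]; apply: towerP => -[|i].
    by rewrite /=; apply: oddzP; apply/negbTE.
  by rewrite x1.
have [|f f_add fE] := @derivation_on_inner _ _ _ (@even_below_sub 1) M d projM.
  split=> [x _ m n|x y x1 y1]; first by rewrite /d mulrzDl.
  rewrite conj_d; apply/funext => m; rewrite -[RHS]/(d x m + d y m) /d -mulrzDr.
  rewrite {1}(even_below1P x x1) {1}(even_below1P y y1) -baseD -mulrDr /=.
  by rewrite mulKz.
have f2 x : x \in even_below 1 -> conjf x f = f - d x.
  by move=> /fE ->; rewrite opprB addrC subrK.
exists (f - conjf (base 1) f); split.
- by apply: additiveD => //; apply/additiveN/additive_conjf.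
- move=> x x1; rewrite conjfB -conjfM.
  have -> : (x * base 1 = base 1 * x)%g.
    by rewrite (even_below1P x x1) -!baseD addrC.
  by rewrite conjfM (f2 x x1) conjfB conj_d opprB addrA subrK.
- rewrite conjfB -conjfM -baseD addrA subrK -fE; last first.
    by have -> : (1 + 1 : int) = 2 * 1 by []; exact: even_below_base.
  by apply/funext => m; rewrite /d.
Qed.

Lemma below_generated n (P : tower -> Prop) :
  (forall x y, P x -> P y -> P (x * y)%g) ->
  (forall x, x \in even_below n.+1 -> P x) -> P (base 1) ->
  forall x, x \in below n.+1 -> P x.
Proof.
move=> PM Peven P1 x xn; have [cx|cx] := boolP (chi x); last first.
  by apply: Peven; rewrite even_belowP xn.
rewrite -[x](mulgK (base (- 1))) -baseN opprK; apply: PM => //; apply: Peven.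
by rewrite even_belowP gpredM ?below_base// chiM cx.
Qed.

Lemma conjf_pull (M : gmodule tower) (h : {multiplicative tower -> tower}) x
    (f : M -> M) : conjf (M := pull h M) x f = conjf (h x) f.
Proof.
by apply/funext => m; rewrite /conjf -mult_inv.
Qed.

Section RestrictedTwist.

Fact twist_even_subproof (x : subgroup_type even_subgroup) :
  embed_twist (sg_val x) \in even_subgroup.
Proof. by case: x => x /=; rewrite !even_subgroupE chi_embed_twist. Qed.
Definition twist_even x : subgroup_type even_subgroup :=
  SubgroupElt (twist_even_subproof x).
Fact twist_evenM : {morph twist_even : x y / (x * y)%g}.
Proof. by move=> x y; apply: val_inj; rewrite /= gmulfM. Qed.
HB.instance Definition _ := isMultiplicative.Build
  (subgroup_type even_subgroup) (subgroup_type even_subgroup) twist_even twist_evenM.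

Lemma projective_twist (M : gmodule tower) :
  projective_gmodule (res_gmodule even_subgroup M) ->
  projective_gmodule (res_gmodule even_subgroup (pull embed_twist M)).
Proof.
have inj : injective twist_even.
  by move=> x y /(congr1 val) /embed_twist_inj xy; apply: val_inj.
move/(projective_pull inj).
apply: (@projective_iso _ (pull twist_even (res_gmodule even_subgroup M))
  (res_gmodule even_subgroup (pull embed_twist M)) id id) => //.
Qed.

End RestrictedTwist.

(** The group generated by [base 2] and [reflection] is infinite dihedral. *)
Definition reflection := embed (base 1).

Lemma reflection_base k : (reflection * base k = base (- k) * reflection)%g.
Proof. by rewrite /reflection embed_base. Qed.

Lemma embed_base_even n x k : x \in even_below n ->
  (embed x * base k = base k * embed x)%g.
Proof. by rewrite even_belowP embed_base => /andP[_ /negPf ->]. Qed.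

Section DihedralDerivation.
Variables (M : gmodule tower) (n : nat) (delta : M -> M).
Hypothesis delta_add : additive_map delta.
Hypothesis delta_even :
  forall x, x \in even_below n.+1 -> conjf (embed x) delta = delta.
Hypothesis delta_u : conjf reflection delta = - conjf (base (- 2)) delta.

(** Modulo the image of the even elements under [embed], the even elements of the
    next level form the infinite dihedral group of [base 2] and [reflection], the
    free product of the groups of order 2 of [reflection] and of
    [base 2 * reflection].  A derivation vanishing on the first is determined by
    its value [delta] on the second, which is also its value on [base 2], and
    the hypothesis [delta_u] is the condition that this value must satisfy. *)
Lemma exists_dihedral_derivation : exists2 d : tower -> M -> M,
  derivation_on (even_below n.+2) d &
  forall x : tower, (x 0%N = 0 -> d x = 0) /\ (x 0%N = 2 -> d x = delta).
Proof.
have [D [D0 DS]] := exists_antidifference (fun k => conjf (base (2 * k)) delta).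
have D_add k : additive_map (D k).
  have c_add j : additive_map (conjf (base (2 * j)) delta).
    exact: additive_conjf.
  elim/int_step_ind: k => [|k]; first by rewrite D0 => a b; rewrite -[LHS]addr0.
  rewrite DS; split=> Dk; first exact: additiveD.
  rewrite -[D k](addrK (conjf (base (2 * k)) delta)).
  by apply: additiveD => //; apply: additiveN.
have D_plus k l : D (k + l) = D k + conjf (base (2 * k)) (D l).
  elim/int_step_ind: l => [|l]; first by rewrite D0 conjf0 !addr0.
  rewrite addrA !DS conjfD -conjfM -baseD -mulrDr addrA.
  by split=> [-> //|/addIr].
have D_even x l : x \in even_below n.+1 -> conjf (embed x) (D l) = D l.
  move=> xn; elim/int_step_ind: l => [|l]; first by rewrite D0 conjf0.
  rewrite DS conjfD -conjfM (embed_base_even _ xn) conjfM delta_even//.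
  by split=> [-> //|/addIr].
have D_u l : conjf reflection (D l) = D (- l).
  elim/int_step_ind: l => [|l]; first by rewrite oppr0 D0 conjf0.
  have -> : D (- l) = D (- (l + 1)) + conjf (base (2 * - (l + 1))) delta.
    by rewrite -DS; congr D; ring.
  rewrite DS conjfD -conjfM reflection_base conjfM delta_u conjfN -conjfM -baseD.
  have -> : - (2 * l) + - 2 = 2 * - (l + 1) :> int by ring.
  by split=> [-> |/(canRL (subrK _)) //]; rewrite ?addrK.
have D_flip b l : b \in below n.+1 -> conjf (embed b) (D l) = D (flip (chi b) l).
  move=> bn; move: b bn l; apply: below_generated => [x y Dx Dy l|x xn l|l].
  - rewrite gmulfM conjfM Dy Dx chiM.
    by congr D; case: (chi x); case: (chi y); rewrite /= ?opprK.
  - by rewrite D_even//; move: xn; rewrite even_belowP => /andP[_ /negPf ->].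
  - exact: D_u.
exists (fun x => D (x 0%N %/ 2)%Z); last first.
  move=> x; split=> ->; first by rewrite div0z.
  rewrite -[(2 %/ 2)%Z]/(0 + 1 : int) DS D0 add0r mulr0 base0.
  exact: conjf1.
split=> [x _|x y xn yn]; first exact: D_add.
have half z : z \in even_below n.+2 -> z 0%N = 2 * (z 0%N %/ 2)%Z.
  by rewrite even_belowP => /andP[_ /negPf]; exact: oddzP.
have bn : drop_first x \in below n.+1.
  by apply: below_drop_first; move: xn; rewrite even_belowP => /andP[].
rewrite {3}[x]towerE conjfM D_flip// {2}(half x xn) -D_plus; congr D.
rewrite coordM -/(chi (drop_first x)) {1}(half x xn) {1}(half y yn).
set k := (x 0%N %/ 2)%Z; set l := (y 0%N %/ 2)%Z.
case: (chi _); rewrite /flip.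
  by rewrite -mulrN -mulrDr mulKz.
by rewrite -mulrDr mulKz.
Qed.

End DihedralDerivation.

Lemma sub_swap (V : zmodType) (a b c d : V) : a - b = c - d -> a - c = b - d.
Proof. by move/(canRL (subrK _)) ->; rewrite addrAC [c - d]addrC addrK addrC. Qed.

Lemma add_swap (V : zmodType) (a b c d : V) : a + b = c + d -> b - d = c - a.
Proof. by move/(canRL (addKr _)) ->; rewrite addrA addrK addrC. Qed.

Lemma subrACA (V : zmodType) (a b c d : V) : a - b - (c - d) = a - c - (b - d).
Proof. by rewrite !opprB addrACA [- b - c]addrC addrACA. Qed.

(** The passage from one level to the next.  The endomorphism [f0] comes from the
    induction hypothesis along [embed_twist]: it is a half trace for [t] in place
    of [base 1], but is only fixed by the images of even elements. *)
Section InductiveStep.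
Variables (M : gmodule tower) (n : nat) (f0 : M -> M).
Hypothesis projM : projective_gmodule (res_gmodule even_subgroup M).
Let u := reflection.
Let t := embed_twist (base 1).
Hypothesis f0_add : additive_map f0.
Hypothesis f0_even : forall x, x \in even_below n.+1 -> conjf (embed x) f0 = f0.
Hypothesis f0_half : f0 + conjf t f0 = id.

Let tE : t = (base 1 * u)%g.
Proof. exact: embed_twistE. Qed.

Let uu_even : exists2 x, x \in even_below n.+1 & (u * u = embed x)%g.
Proof.
exists (base (2 * 1)); first exact: even_below_base.
by rewrite /u /reflection -gmulfM -baseD.
Qed.

Let embed_u x : (embed x * u = u * embed (x ^ base 1)%g)%g.
Proof. by rewrite /u /reflection -!gmulfM /conjg mulVKg. Qed.

Let delta : M -> M := f0 - conjf (base 2 * u)%g f0.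

Let delta_even x : x \in even_below n.+1 -> conjf (embed x) delta = delta.
Proof.
move=> xn; rewrite /delta conjfB f0_even// -conjfM mulgA (embed_base_even _ xn).
rewrite -mulgA embed_u mulgA [in LHS]conjfM f0_even//.
exact: even_below_conj.
Qed.

Let delta_u : conjf u delta = - conjf (base (- 2)) delta.
Proof.
have vu_delta : conjf (base 2 * u)%g delta = - delta.
  rewrite /delta conjfB -conjfM opprB.
  have [x xn uuE] := uu_even.
  suff -> : ((base 2 * u) * (base 2 * u) = embed x)%g by rewrite f0_even.
  by rewrite -mulgA (mulgA u) reflection_base -mulgA uuE mulgA -baseD subrr base0 mul1g.
rewrite -conjfN -vu_delta -conjfM mulgA -baseD addrC subrr base0.
by rewrite mul1g.
Qed.

(** Let [u] be the reflection and [v = base 2].  An inner form [g] of the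
    derivation of the preceding lemma, for [delta = f0 - (v u) f0], splits [f0]
    as [g + b], where [g] is fixed by [embed (below n.+1)] and [b] by [v u].
    Conjugation by [t] exchanges [u] and [v u], so [g + t b] is also fixed by
    [embed (below n.+1)], and it has the same sum with its [t]-conjugate as
    [f0].  Being fixed by [u], it has the same conjugates by [t] and by
    [base 1]. *)
Lemma half_trace_step : exists f : M -> M, half_trace n.+2 f.
Proof.
have delta_add : additive_map delta.
  by apply: additiveD => //; apply/additiveN/additive_conjf.
have [d d_der dE] := exists_dihedral_derivation delta_add delta_even delta_u.
have [g g_add gE] := derivation_on_inner (@even_below_sub n.+2) projM d_der.
have g_below b : b \in below n.+1 -> conjf (embed b) g = g.
  move=> bn; have := gE _ (even_below_embed bn).
  by rewrite (proj1 (dE _))// => /eqP; rewrite eq_sym subr_eq0 => /eqP <-.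
have un : u \in even_below n.+2 by apply: even_below_embed; exact: below_base.
have vun : (base 2 * u)%g \in even_below n.+2.
  by apply: gpredM => //; exact: (even_below_base n.+1 1).
pose b := f0 - g.
have b_add : additive_map b by apply: additiveD => //; exact: additiveN.
have b_even x : x \in even_below n.+1 -> conjf (embed x) b = b.
  move=> xn; rewrite conjfB f0_even// g_below//.
  by move: xn; rewrite even_belowP => /andP[].
have b_vu : conjf (base 2 * u)%g b = b.
  have := gE _ vun; rewrite (proj2 (dE _))//.
  by rewrite /b conjfB => /sub_swap.
pose f := g + conjf t b.
have f_half_t : f + conjf t f = id.
  rewrite /f conjfD -conjfM.
  have -> : (t * t)%g = embed (base (2 * 1)).
    by rewrite /t -embed_twistM -baseD embed_twist_even.
  rewrite b_even ?even_below_base// addrACA [conjf t b + b]addrC.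
  by rewrite addrACA -conjfD /b [g + _]addrC subrK.
have f_u : conjf u f = f.
  rewrite /f conjfD (g_below _ (below_base _ _)) -conjfM; congr (g + _).
  have -> : (u * t = t * (base 2 * u))%g.
    rewrite tE !mulgA reflection_base -[in RHS](mulgA (base 1)) reflection_base.
    by rewrite mulgA -baseD.
  by rewrite conjfM b_vu.
have f_below c : c \in below n.+1 -> conjf (embed c) f = f.
  move: c; apply: below_generated => [x y fx fy|x xn|//].
    by rewrite gmulfM conjfM fy.
  rewrite /f conjfD g_below; last by move: xn; rewrite even_belowP => /andP[].
  rewrite -conjfM; congr (g + _).
  rewrite tE mulgA (embed_base_even _ xn) -mulgA embed_u mulgA [LHS]conjfM.
  by rewrite b_even// even_below_conj.
have f_half : f + conjf (base 1) f = id by rewrite -{2}f_u -conjfM -tE.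
have f_base2 : conjf (base 2) f = f.
  rewrite -[base 2]/(base (1 + 1)) baseD conjfM.
  have s_f : conjf (base 1) f = id - f by rewrite -f_half addrC addKr.
  by rewrite s_f conjfB conjf_id s_f opprB addrC subrK.
exists f; split=> //; first by apply: additiveD => //; apply: additive_conjf.
move=> x; rewrite even_belowP => /andP[xn /negPf cx].
rewrite [x]towerE conjfM f_below ?below_drop_first// (oddzP cx).
elim/int_step_ind: (_ %/ 2)%Z => [|k]; first by rewrite mulr0 base0 conjf1.
by rewrite mulrDr mulr1 baseD conjfM f_base2.
Qed.

End InductiveStep.

(** Along [embed_twist] the even elements pull back to the even elements, so the
    induction hypothesis applies to the restricted module. *)
Lemma exists_half_trace (M : gmodule tower) n :
  projective_gmodule (res_gmodule even_subgroup M) ->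
  exists f : M -> M, half_trace n.+1 f.
Proof.
elim: n M => [|n IHn] M projM; first exact: half_trace1.
have [f [f_add f_even f_half]] := IHn _ (projective_twist projM).
apply: (@half_trace_step M n f) => //.
  move=> x xn; rewrite -embed_twist_even; last exact: (even_below_sub xn).
  by rewrite -conjf_pull f_even.
by rewrite -conjf_pull f_half.
Qed.

(** Half traces [f n] for the levels need not be compatible.  Two consecutive ones
    differ by a function [e n - s (e n)], with [e n] fixed by the even elements of
    level [n.+1]: a function [h] with [s h = - h] equals [h f - s (h f)] for every
    half trace [f].  The partial sums [tau n] of the [e n] define a derivation on
    the union, inner by some [g]; adding [(g - tau n) - s (g - tau n)] to [f n]
    then gives a function independent of [n].  This is the vanishing of a first
    derived limit. *)
Lemma exists_global_half_trace (M : gmodule tower) :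
  projective_gmodule (res_gmodule even_subgroup M) ->
  exists f : M -> M, [/\ additive_map f,
    forall x, x \in even_subgroup -> conjf x f = f & f + conjf (base 1) f = id].
Proof.
move=> projM.
have ex n := exists_half_trace n projM.
pose f n := sval (cid (ex n)).
have fP n : half_trace n.+1 (f n) := svalP (cid (ex n)).
pose s := base 1.
pose e n := (f n.+1 - f n) \o f n.
have even_mono m n x : (m <= n)%N -> x \in even_below m -> x \in even_below n.
  move=> mn; rewrite !even_belowP => /andP[/belowP xm ->]; rewrite andbT.
  by apply/belowP => i ni; apply/xm/(leq_trans mn).
have e_add n : additive_map (e n).
  have [fn_add _ _] := fP n; have [fn1_add _ _] := fP n.+1.
  move=> a b; rewrite /e /= fn_add.
  by apply: additiveD => //; apply: additiveN.
have e_even n x : x \in even_below n.+1 -> conjf x (e n) = e n.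
  move=> xn; have [_ fn _] := fP n; have [_ fn1 _] := fP n.+1.
  by rewrite conjf_comp conjfB fn// fn1// (even_mono _ _ _ _ xn).
have e_diff n : f n.+1 - f n = e n - conjf s (e n).
  have [fn_add _ fn] := fP n; have [fn1_add _ fn1] := fP n.+1.
  have d_add : additive_map (f n.+1 - f n).
    by apply: additiveD => //; apply: additiveN.
  have -> : conjf s (e n) = - ((f n.+1 - f n) \o conjf s (f n)).
    rewrite conjf_comp -[RHS]/((- (f n.+1 - f n)) \o conjf s (f n)); congr (_ \o _).
    by rewrite conjfB opprB; apply: add_swap; rewrite fn1 fn.
  rewrite opprK; apply/funext => m.
  rewrite -[RHS]/((f n.+1 - f n) (f n m) + (f n.+1 - f n) (conjf s (f n) m)) -d_add.
  by rewrite -[f n m + _]/((f n + conjf s (f n)) m) fn.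
pose tau n := \sum_(i < n) e i.
have tauS n : tau n.+1 = tau n + e n by rewrite /tau big_ord_recr.
have tau_add n : additive_map (tau n).
  elim: n => [|n IHn]; last by rewrite tauS; apply: additiveD.
  by rewrite /tau big_ord0 => a b; rewrite -[LHS]addr0.
have tau_stable m n x : (m <= n)%N -> x \in even_below m.+1 ->
    tau n - conjf x (tau n) = tau m - conjf x (tau m).
  move=> mn xm; rewrite -(subnK mn); elim: (n - m)%N => [//|k IHk].
  rewrite addSn tauS conjfD e_even; last by apply: even_mono xm; rewrite ltnS leq_addl.
  by rewrite opprD addrACA subrr addr0.
pose bd (x : tower) := sval (cid (tower_bound x)).
have bdP x : x \in even_subgroup -> x \in even_below (bd x).+1.
  rewrite even_subgroupE even_belowP => ->; rewrite andbT.
  by apply/belowP => i bi; apply: (svalP (cid (tower_bound x))); apply: ltnW.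
pose d (x : tower) := tau (bd x) - conjf x (tau (bd x)).
have dE n x : x \in even_below n.+1 -> d x = tau n - conjf x (tau n).
  move=> xn; have xb := bdP x (even_below_sub xn).
  have [bn|nb] := leqP (bd x) n; first by rewrite (tau_stable _ _ _ bn xb).
  by rewrite /d (tau_stable _ _ _ (ltnW nb) xn).
have d_der : derivation_on even_subgroup d.
  split=> [x _|x y xe ye].
    by apply: additiveD => //; apply/additiveN/additive_conjf.
  pose n := maxn (bd x) (bd y).
  have xn : x \in even_below n.+1.
    by apply: even_mono (bdP x xe); rewrite ltnS leq_maxl.
  have yn : y \in even_below n.+1.
    by apply: even_mono (bdP y ye); rewrite ltnS leq_maxr.
  rewrite (dE n _ xn) (dE n _ yn) (dE n); last exact: gpredM.
  by rewrite conjfB conjfM addrA subrK.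
have [g g_add gE] := derivation_on_inner (S := even_subgroup) (fun _ => id) projM d_der.
pose r n := g - tau n.
have r_even n x : x \in even_below n.+1 -> conjf x (r n) = r n.
  move=> xn; have := gE x (even_below_sub xn).
  by rewrite (dE n _ xn) /r conjfB => /sub_swap /(congr1 -%R); rewrite !opprB.
pose h n := f n + (r n - conjf s (r n)).
have hS n : h n.+1 = h n.
  rewrite /h; have -> : r n.+1 = r n - e n by rewrite /r tauS opprD addrA.
  have -> : f n.+1 = f n + (e n - conjf s (e n)) by rewrite -e_diff addrC subrK.
  have -> : r n - e n - conjf s (r n - e n) =
      r n - conjf s (r n) - (e n - conjf s (e n)).
    by rewrite conjfB subrACA.
  by rewrite -addrA [(e n - _) + _]addrC subrK.
have h0 n : h n = h 0%N by elim: n => [//|n IHn]; rewrite hS.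
have ss_even : (s * s)%g \in even_below 1.
  by rewrite /s -baseD; exact: (even_below_base 0 1).
have r_add : additive_map (r 0%N) by apply: additiveD => //; exact: additiveN.
have [f_add _ f_half] := fP 0%N.
exists (h 0%N); split.
- by do 2!apply: additiveD => //; apply/additiveN/additive_conjf.
- move=> x xe; rewrite -(h0 (bd x)).
  have xn := bdP x xe; have [_ f_even _] := fP (bd x).
  rewrite /h (conjfD x (f _)) (conjfB x (r _)) (f_even _ xn) (r_even _ _ xn) -conjfM.
  have -> : (x * s = s * (x ^ s))%g by rewrite /conjg mulVKg.
  by rewrite conjfM (r_even _ _ (even_below_conj xn)).
- rewrite -/s /h (conjfD s (f _)) (conjfB s (r _)) -conjfM (r_even _ _ ss_even).
  rewrite addrACA f_half.
  by rewrite -(opprB (r 0%N)) subrr addr0.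
Qed.

(** Higman's criterion: a lift over the even subgroup of the composite of the
    given map with [f] has for trace a lift over the whole group. *)
Lemma projective_of_half_trace (M : gmodule tower) (f : M -> M) :
  additive_map f -> (forall x, x \in even_subgroup -> conjf x f = f) ->
  f + conjf (base 1) f = id ->
  projective_gmodule (res_gmodule even_subgroup M) -> projective_gmodule M.
Proof.
move=> f_add f_even f_half projM A B g k [gD gM] g_surj [kD kM].
pose s := base 1.
have f_comm x m : x \in even_subgroup -> f (gact x m) = gact x (f m).
  by move=> xe; rewrite -{1}(f_even x xe) /conjf gactK.
have [||l [lD lM] lE] := projM (res_gmodule even_subgroup A)
    (res_gmodule even_subgroup B) g (k \o f) _ g_surj.
- by split=> // x m; apply: gM.
- split=> [m n|x m] /=; first by rewrite f_add kD.
  by rewrite /res_gact f_comm ?kM//; case: x.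
have l_comm x m : x \in even_subgroup -> l (gact x m) = gact x (l m).
  by move=> xe; apply: (lM (SubgroupElt xe)).
have ss_even : (s * s)%g \in even_subgroup by rewrite even_subgroupE chiM.
pose L m := l m + gact s (l (gact s^-1%g m)).
have LD m n : L (m + n) = L m + L n by rewrite /L gactD !lD gactD addrACA.
have L_even x m : x \in even_subgroup -> L (gact x m) = gact x (L m).
  move=> xe; rewrite /L l_comm// gactD; congr (_ + _).
  have xs : (x ^ s)%g \in even_subgroup by exact: even_part_normal.
  rewrite -!gactM.
  have -> : (s^-1 * x = (x ^ s) * s^-1)%g by rewrite /conjg mulgA mulgK.
  rewrite (gactM (x ^ s)%g) (l_comm _ _ xs) -!gactM.
  by rewrite /conjg mulVKg.
have L_s m : L (gact s m) = gact s (L m).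
  rewrite /L gactD gactK addrC; congr (_ + _).
  rewrite -gactM -(l_comm _ _ ss_even); congr l.
  by rewrite -gactM mulgK.
exists L.
  split=> // x m; have [cx|cx] := boolP (chi x); last by apply: L_even.
  rewrite -[x](mulgVK s) gactM L_even ?L_s -?gactM//.
  by rewrite even_subgroupE chiM chiV cx.
move=> m; rewrite /L gD gM !lE /= -kM -kD.
by rewrite -[in RHS]/(id m) -f_half.
Qed.

Lemma moore_conjecture_even : moore_conjecture even_subgroup.
Proof.
split=> [|M projM]; first exact: moore_condition_even.
have [f [f_add f_even f_half]] := exists_global_half_trace projM.
exact: (projective_of_half_trace f_add f_even f_half projM).
Qed.

(** * The line as a cell complex *)

Section Line.
Variable R : realType.
Local Open Scope classical_set_scope.

Definition line_dim (a : bool * int) : nat := a.1.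

(** The cell [(false, k)] is the vertex [k] and [(true, k)] the edge from [k] to
    [k + 1]; the sum has one term for an edge and none for a vertex, so that a
    single formula, with the inverse [line_chart], covers both. *)
Definition line_char (a : bool * int) (v : 'rV[R]_(line_dim a)) : R :=
  a.2%:~R + \sum_i (1 + v 0 i) / 2.

Definition line_chart (a : bool * int) (x : R) : 'rV[R]_(line_dim a) :=
  const_mx (2 * (x - a.2%:~R) - 1).

Lemma coordinate_continuous n (i : 'I_n) : continuous (fun v : 'rV[R]_n => v 0 i).
Proof.
move=> v A vA; exists (fun k j => if j == i then A else setT).
  by move=> k j; rewrite (ord1 k); case: eqP => [->|_] //; exact: filterT.
by move=> w /(_ 0 i); rewrite eqxx.
Qed.

Lemma line_char_vertex k v : @line_char (false, k) v = k%:~R.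
Proof. by rewrite /line_char /= big_ord0 addr0. Qed.

Lemma line_char_edge k v : @line_char (true, k) v = k%:~R + (1 + v 0 ord0) / 2.
Proof. by rewrite /line_char /= big_ord_recl big_ord0 addr0. Qed.

Lemma line_char_continuous a : continuous (@line_char a).
Proof.
case: a => -[] k.
  have -> : @line_char (true, k) = fun v => k%:~R + (1 + v 0 ord0) / 2.
    by apply/funext => v; exact: line_char_edge.
  move=> v; apply: (@continuous_comp _ _ _ (fun w : 'rV[R]_1 => w 0 ord0)
      (fun y => k%:~R + (1 + y) / 2)); first exact: coordinate_continuous.
  apply: cvgD; first exact: cvg_cst.
  apply: cvgM; last exact: cvg_cst.
  by apply: cvgD; [exact: cvg_cst | exact: cvg_id].
have -> : @line_char (false, k) = fun=> k%:~R.
  by apply/funext => v; exact: line_char_vertex.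
by move=> v; exact: cst_continuous.
Qed.

Lemma line_chart_continuous a : continuous (@line_chart a).
Proof.
move=> x; apply/cvg_ballP => e e0.
have aff : (fun y : R => 2 * (y - a.2%:~R) - 1) @ x --> 2 * (x - a.2%:~R) - 1.
  apply: cvgB; last exact: cvg_cst.
  by apply: cvgM; [exact: cvg_cst | apply: cvgB => //; exact: cvg_cst].
move/cvg_ballP: aff => /(_ e e0); apply: filterS => y ye.
by split=> // i j; rewrite !mxE.
Qed.

Lemma line_charK a : cancel (@line_char a) (@line_chart a).
Proof.
case: a => -[] k v; apply/rowP => -[i il]; last by [].
rewrite !mxE /line_char /line_chart /= big_ord_recl big_ord0 addr0.
have -> : Ordinal il = ord0 by apply: val_inj; case: i il.
by field.
Qed.

Lemma line_chartK k : cancel (@line_chart (true, k)) (@line_char (true, k)).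
Proof.
move=> x; rewrite /line_char /line_chart /= big_ord_recl big_ord0 addr0 mxE.
by field.
Qed.

Lemma sum_sqr_line_chart k (x : R) :
  \sum_i (@line_chart (true, k) x) 0 i ^+ 2 = (2 * (x - k%:~R) - 1) ^+ 2.
Proof. by rewrite big_ord_recl big_ord0 addr0 mxE. Qed.

Lemma line_vertex k (D : set 'rV[R]_0) : D 0 ->
  @line_char (false, k) @` D = [set k%:~R].
Proof.
move=> D0; apply/seteqP; split=> [_ [v _ <-]|_ ->].
  by rewrite /line_char /= big_ord0 addr0.
by exists 0 => //; rewrite /line_char /= big_ord0 addr0.
Qed.

Lemma line_edge_open k : @line_char (true, k) @` (@open_disc R 1) =
  [set x | k%:~R < x < k%:~R + 1].
Proof.
apply/seteqP; split=> x.
  move=> [v]; rewrite /open_disc /= big_ord_recl big_ord0 addr0 => v1 <-.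
  by rewrite /line_char /= big_ord_recl big_ord0 addr0; nra.
move=> /= xk; exists (line_chart (true, k) x); last exact: line_chartK.
by rewrite /open_disc /= sum_sqr_line_chart; nra.
Qed.

Lemma line_edge_closed k : @line_char (true, k) @` (@closed_disc R 1) =
  [set x | k%:~R <= x <= k%:~R + 1].
Proof.
apply/seteqP; split=> x.
  move=> [v]; rewrite /closed_disc /= big_ord_recl big_ord0 addr0 => v1 <-.
  by rewrite /line_char /= big_ord_recl big_ord0 addr0; nra.
move=> /= xk; exists (line_chart (true, k) x); last exact: line_chartK.
by rewrite /closed_disc /= sum_sqr_line_chart; nra.
Qed.

Definition line_cell (a : bool * int) : set R :=
  @line_char a @` @open_disc R (line_dim a).

Lemma line_cellP a x :
  line_cell a x <->
  if a.1 then is_true (a.2%:~R < x < a.2%:~R + 1) else x = a.2%:~R.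
Proof.
case: a => -[] k; rewrite /line_cell; first by rewrite line_edge_open.
by rewrite line_vertex// /open_disc /= big_ord0.
Qed.

Definition line_center (a : bool * int) : R := a.2%:~R + if a.1 then 2^-1 else 0.

Lemma line_cell_center a : line_cell a (line_center a).
Proof.
apply/line_cellP; case: a => -[] k; rewrite /line_center /= ?addr0//.
by apply/andP; split; lra.
Qed.

Lemma line_cover : \bigcup_a line_cell a = setT.
Proof.
apply/seteqP; split=> // x _.
have /andP[fx xf] := floor_itv x.
have [xE|xE] := eqVneq x (Num.floor x)%:~R.
  by exists (false, Num.floor x) => //; apply/line_cellP.
exists (true, Num.floor x) => //; apply/line_cellP => /=.
by rewrite lt_neqAle eq_sym xE fx -(intrD _ _ 1).
Qed.

Lemma line_disjoint a b : line_cell a `&` line_cell b !=set0 -> a = b.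
Proof.
case=> x [/line_cellP + /line_cellP].
case: a => -[] k; case: b => -[] l /=.
- move=> /andP[kx xk] /andP[lx xl]; congr pair.
  have : (k%:~R < l%:~R + 1 :> R) by exact: lt_trans xl.
  have : (l%:~R < k%:~R + 1 :> R) by exact: lt_trans xk.
  rewrite -!(intrD _ _ 1) !ltr_int; lia.
- move=> /andP[kx xk] xE; move: kx xk; rewrite xE -(intrD _ _ 1) !ltr_int; lia.
- move=> -> /andP[]; rewrite -(intrD _ _ 1) !ltr_int; lia.
- by move=> -> /intr_inj ->.
Qed.

Lemma line_closure_finite a : exists S : set (bool * int),
  [/\ finite_set S, forall b, S b -> (line_dim b < line_dim a)%N &
      @line_char a @` @disc_boundary R (line_dim a) `<=` \bigcup_(b in S) line_cell b].
Proof.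
case: a => -[] k.
  exists [set (false, k); (false, k + 1)]; split.
  - exact: finite_set2.
  - by move=> b [] ->.
  - move=> _ [v vb <-]; rewrite line_char_edge; move: vb.
    rewrite /disc_boundary /= big_ord_recl big_ord0 addr0 => /eqP.
    rewrite sqrf_eq1 => /orP[] /eqP ->.
      exists (false, k + 1); first by right.
      by apply/line_cellP; rewrite /= intrD; lra.
    exists (false, k); first by left.
    by apply/line_cellP; rewrite /= subrr mul0r addr0.
exists set0; split=> // _ [v vb <-]; move: vb.
by rewrite /disc_boundary /= big_ord0 => /eqP; rewrite eq_sym oner_eq0.
Qed.

(** Every point has a neighbourhood covered by two closed edges. *)
Lemma line_weak (A : set R) :
  (forall a, closed (A `&` @line_char a @` @closed_disc R (line_dim a))) -> closed A.
Proof.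
move=> clA x Ax; set m := Num.floor x.
have /andP[mx xm] := Num.Theory.floor_itv x; rewrite -/m in mx xm.
have cl k : closed (A `&` [set y | k%:~R <= y <= k%:~R + 1]).
  by have := clA (true, k); rewrite /= line_edge_closed.
suff Cx : closure (A `&` [set y | (m - 1)%:~R <= y <= (m - 1)%:~R + 1] `|`
    A `&` [set y | m%:~R <= y <= m%:~R + 1]) x.
  by have [[Ay _]|[Ay _]] := closedU (cl _) (cl _) Cx; exact: Ay.
move=> B Bx.
have xo : x \in `](m - 1)%:~R, (m + 1)%:~R[%R.
  rewrite in_itv /= xm andbT (lt_le_trans _ mx)// ltr_int; lia.
have [y [Ay [By yo]]] := Ax _ (filterI Bx (near_in_itvoo xo)).
exists y; split=> //; move: yo; rewrite /= in_itv /= => /andP[y1 y2].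
have [ym|my] := leP y m%:~R.
  by left; split=> //=; rewrite (ltW y1) -(intrD _ _ 1) subrK.
by right; split=> //=; rewrite (ltW my) -(intrD _ _ 1) ltW.
Qed.

Definition line_structure : cw_structure R R.
Proof.
refine (@CWStructure R R (bool * int)%type line_dim line_char
  (@Rhausdorff R) _ _ _ line_cover line_disjoint line_closure_finite line_weak).
- by move=> a; apply: continuous_subspaceT; exact: line_char_continuous.
- by move=> a v w _ _; exact: can_inj (@line_charK a) v w.
- move=> a U oU; exists (line_chart a @^-1` U).
    by apply: open_comp oU => x _; exact: line_chart_continuous.
  apply/seteqP; split=> [_ [v [Uv Dv] <-]|x [Uv [v Dv vE]]].
    by split; [rewrite /= line_charK | exists v].
  by exists v => //; split=> //; move: Uv; rewrite -vE /= line_charK.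
Defined.

Lemma line_finite_dimensional : finite_dimensional line_structure.
Proof. by exists 1%N => -[[]]. Qed.

Lemma line_contractible : contractible R R.
Proof.
exists 0, (fun p => (1 - p.2) * p.1); split=> [|x|x].
- apply: continuous_subspaceT => p; apply: cvgM; last exact: cvg_fst.
  by apply: cvgB; [exact: cvg_cst | exact: cvg_snd].
- by rewrite /= subr0 mul1r.
- by rewrite /= subrr mul0r.
Qed.

Definition line_act (a : tower) (x : R) : R :=
  (-1) ^+ oddz (a 1%N) * x + (2 * a 0%N)%:~R.

Lemma line_act1 x : line_act 1%g x = x.
Proof. by rewrite /line_act !coord1 mulr0 addr0 mul1r. Qed.

Lemma line_actM a b x : line_act (a * b)%g x = line_act a (line_act b x).
Proof.
rewrite /line_act !coordM oddzD oddz_flip signr_addb !intrM intrD.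
by rewrite /flip; case: (oddz (a 1%N)); rewrite ?intrN; ring.
Qed.

Lemma line_act_continuous a : continuous (line_act a).
Proof.
move=> x; apply: cvgD; last exact: cvg_cst.
by apply: cvgM; [exact: cvg_cst | exact: cvg_id].
Qed.

Definition line_move (a : tower) (c : bool * int) : bool * int :=
  (c.1, if oddz (a 1%N) then 2 * a 0%N - c.2 - (c.1 : nat)%:Z else c.2 + 2 * a 0%N).

Lemma line_act_sub a c x : line_cell c x -> line_cell (line_move a c) (line_act a x).
Proof.
move=> /line_cellP cx; apply/line_cellP; rewrite /line_move /line_act.
case: c cx => -[] k /=; case: (oddz (a 1%N));
  rewrite ?expr0 ?expr1 ?mul1r ?mulN1r ?intrD ?intrN ?intrM.
- by move=> ?; lra.
- by move=> ?; lra.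
- by move=> ->; rewrite subr0; ring.
- by move=> ->.
Qed.

Lemma line_act_cell a c : line_act a @` line_cell c = line_cell (line_move a c).
Proof.
apply/seteqP; split=> [_ [x cx <-]|x cx]; first exact: line_act_sub.
exists (line_act a^-1%g x); last by rewrite -line_actM mulgV line_act1.
have := line_act_sub a^-1%g cx; congr line_cell; apply/eqP.
rewrite /line_move !coordV oddzN oddz_flip /flip -pair_eqE /= eqxx /=.
by case: (oddz (a 1%N)); apply/eqP; ring.
Qed.

Section Action.
Variables (G : groupType) (phi : {multiplicative G -> tower}).

Fact line_cellular g c : exists2 c' : cw_index line_structure,
  cw_dim c' = cw_dim (c : cw_index line_structure) &
  line_act (phi g) @` cw_cell (c : cw_index line_structure) = cw_cell c'.
Proof. by exists (line_move (phi g) c) => //; exact: line_act_cell. Qed.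

Definition line_action : cellular_action G line_structure :=
  @CellularAction R G R line_structure (fun g => line_act (phi g))
    (fun x => etrans (congr1 (line_act^~ x) (mult_one phi)) (line_act1 x))
    (fun g h x => etrans (congr1 (line_act^~ x) (gmulfM (s := phi) g h))
       (line_actM (phi g) (phi h) x))
    (fun g => @line_act_continuous (phi g)) line_cellular.

(** An orientation preserving element that maps a cell to itself is the identity
    of the line; a reflection has an integral centre, hence fixes no edge. *)
Lemma line_stabilizer (c : cw_index line_structure) :
  [set g | g \in cell_stabilizer line_action c]%classic =
  pointwise_stabilizer line_action c.
Proof.
apply/seteqP; split=> g /=; last first.
  move=> fix_g; apply/asboolP; rewrite -[RHS]image_id.
  by apply: eq_imagel => x cx; exact: fix_g.
move=> /asboolP gc.
have {}gc : line_act (phi g) @` line_cell c = line_cell c := gc.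
have move_c : line_move (phi g) c = c.
  apply: line_disjoint; exists (line_center c); split; last exact: line_cell_center.
  by rewrite -line_act_cell gc; exact: line_cell_center.
move=> x /line_cellP; move: move_c {gc}; case: c => b k; rewrite /line_move.
rewrite -[cact _ _ _]/(line_act (phi g) x) /line_act; case => /=.
case: (oddz (phi g 1%N)) b => -[] /= bk xk.
- by exfalso; lia.
- have -> : 2 * phi g 0%N = 2 * k by lia.
  by rewrite xk expr1 intrM; ring.
- have -> : phi g 0%N = 0 by lia.
  by rewrite mulr0 addr0 mul1r.
- have -> : phi g 0%N = 0 by lia.
  by rewrite mulr0 addr0 mul1r.
Qed.

(** Two elements with the same coordinates from 1 on differ by a translation of
    the line, and a translation that fixes a point is trivial. *)
Lemma line_stabilizer_below (c : cw_index line_structure) : injective phi ->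
  injective (fun g : subgroup_type (cell_stabilizer line_action c) =>
    drop_first (phi (sg_val g))).
Proof.
move=> phi_inj g h gh; apply: val_inj; apply: phi_inj => /=.
set a := phi (sg_val g); set b := phi (sg_val h).
have stab (g' : subgroup_type (cell_stabilizer line_action c)) :
    pointwise_stabilizer line_action c (sg_val g').
  by rewrite -line_stabilizer; case: g'.
have cx := line_cell_center c; set x := line_center c in cx.
have := stab h x cx; rewrite -{2}(stab g x cx) /= /line_act -/a -/b.
have ab i : a i.+1 = b i.+1 by exact: (congr1 (fun d : tower => d i) gh).
rewrite ab => /addrI /intr_inj ab0; apply: towerP => -[|i] //.
by lia.
Qed.

End Action.

(** * Membership in LHF *)

Fixpoint line_level n : group_class :=
  if n is n'.+1 then H1 R (line_level n') else finite_groups.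

(** Stabilizers of cells embed in [below n] by deletion of the first coordinate,
    when the group embeds in [below n.+1]. *)
Lemma line_level_below n (G : groupType) (phi : {multiplicative G -> tower}) :
  injective phi -> (forall g, phi g \in below n) -> line_level n G.
Proof.
elim: n G phi => [|n IHn] G phi phi_inj phi_n.
  rewrite /= /finite_groups; have -> : [set: G] = [set 1%g].
    apply/seteqP; split=> // g _; apply: phi_inj; apply: towerP => i.
    by rewrite mult_one; move/belowP: (phi_n g) => ->.
  exact: finite_set1.
exists R, line_structure, (line_action phi); split.
- exact: line_contractible.
- exact: line_finite_dimensional.
- move=> c; split; first exact: line_stabilizer.
  pose psi (g : subgroup_type (cell_stabilizer (line_action phi) c)) :=
    drop_first (phi (sg_val g)).
  have psiM : {morph psi : g h / (g * h)%g}.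
    by move=> g h; rewrite /psi /= gmulfM drop_firstM.
  pose m := isMultiplicative.Build _ _ psi psiM.
  pose psi' : {multiplicative _ -> _} := HB.pack psi m.
  apply: (IHn _ psi'); first exact: line_stabilizer_below.
  by move=> g; apply: below_drop_first; exact: phi_n.
Qed.

Lemma leq_well_order : well_order leq.
Proof.
move=> A [k Ak]; have ex : exists n, n \in A by exists k.
case: (ex_minnP ex) => m Am m_min; exists m; split.
  by split=> // n; exact: m_min.
by move=> n [An /(_ m Am) nm]; apply/eqP; rewrite eqn_leq nm m_min.
Qed.

Lemma line_level_H_levels : H_levels R leq finite_groups line_level.
Proof.
have ltE v w : wlt leq v w <-> (v < w)%N.
  rewrite /wlt ltn_neqAle; split=> [[-> /eqP ->] //|/andP[/eqP vw ->]].
  by split.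
move=> w G; split=> [w0|v vw|[w_ne w_lim]].
- by case: w w0 => // w /(_ w) []; apply/ltE.
- suff -> : w = v.+1 by [].
  have [/ltE vltw v_max] := vw; apply/eqP; rewrite eqn_leq vltw andbT.
  case: w vltw v_max {vw} => // w _ /(_ w) wv; rewrite ltnS; apply: wv.
  exact/ltE.
- case: w w_ne w_lim => [[]|w _ /(_ w) []]; first by move=> v /ltE.
  by split=> [|u /ltE]; [exact/ltE | rewrite ltnS].
Qed.

Lemma tower_LHF : LHF R tower.
Proof.
move=> S [s sS s_gen].
have [n sn] : exists n, {subset s <= below n}.
  elim: s {sS s_gen} => [|a s [n sn]]; first by exists 0%N.
  have [m am] := tower_bound a; exists (maxn m n) => b.
  rewrite inE => /predU1P[->|/sn /belowP bn]; apply/belowP => i; rewrite geq_max.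
    by move=> /andP[/am].
  by move=> /andP[_ /bn].
have Sn := s_gen (below n) sn.
exists nat, leq, line_level, n; split.
- exact: leq_well_order.
- exact: line_level_H_levels.
pose psi (g : subgroup_type S) : tower := sg_val g.
have psiM : {morph psi : g h / (g * h)%g} by [].
pose m := isMultiplicative.Build _ _ psi psiM.
pose psi' : {multiplicative _ -> _} := HB.pack psi m.
apply: (@line_level_below n _ psi'); first by move=> g h gh; exact: val_inj.
by move=> [g /= gS]; apply: Sn.
Qed.

End Line.

Theorem corollary1p10 (R : realType) :
  exists (Gamma : groupType) (H : normal_subgroup Gamma) (p : nat),
    [/\ prime p,
        has_index H p,
        LHF R Gamma,
        moore_conjecture H &
        forall q : Z_extension p (quotient_group H), ~ nilpotent (bockstein q)].
Proof.
exists tower, even_subgroup, 2%N; split=> //.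
- exact: index_even.
- exact: tower_LHF.
- exact: moore_conjecture_even.
- exact: bockstein_not_nilpotent.
Qed.
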